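(* Let $\varphi:\mathbb{R}^n\to[0,\infty)$ be a log-concave function satisfying the standing regularity and integrability assumptions listed in the context. Then $$\int_{\mathrm{supp}(\varphi)}\varphi\,\ln\big(\det(\mathrm{Hess}(-\ln\varphi))\big)\,dx\ \le\ 2\,\mathrm{Ent}(\varphi)+\|\varphi\|_{L^1}\,\ln\!\left[e^n\left(\int\varphi\,dx\right)\left(\int\varphi^\circ\,dx\right)\right],$$ with equality if $\varphi(x)=Ce^{-\langle Ax,x\rangle}$, where $C$ is a positive constant and $A$ is an $n\times n$ positive definite matrix.
   Context: A function $\varphi:\mathbb{R}^n\to[0,\infty)$ is log-concave if $\varphi=e^{-\psi}$ with $\psi:\mathbb{R}^n\to\mathbb{R}$ convex; $\mathrm{supp}(\varphi)=\{x:\varphi(x)>0\}$ is its support. $\mathrm{Hess}$ denotes the Hessian matrix and $\nabla$ the gradient. The entropy is $\mathrm{Ent}(\varphi)=\int_{\mathrm{supp}(\varphi)}\varphi\ln\varphi\,dx$, and $\|\varphi\|_{L^1}=\int\varphi\,dx$. The dual function of $\varphi$ is $\varphi^\circ(x)=\inf_{y\in\mathbb{R}^n}\frac{e^{-\langle x,y\rangle}}{\varphi(y)}$. Integrals without an indicated domain are over $\mathbb{R}^n$. Standing assumptions: $\psi=-\ln\varphi$ is strictly convex, $\varphi\in C^2(\mathrm{supp}(\varphi))\cap L^1(\mathbb{R}^n,dx)$, $\varphi^\circ\in L^1(\mathrm{supp}(\varphi),dx)$, and $\varphi\,\ln\big(e^{\langle\nabla\varphi,x\rangle/\varphi}\varphi^{-2}\det(\mathrm{Hess}(-\ln\varphi))\big)\in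 L^1(\mathrm{supp}(\varphi),dx)$.
   Formalization: Ent(φ) is taken as ∫φ ln φ dx − ‖φ‖ ln‖φ‖ (L¹ norm) instead of ∫φ ln φ dx; with the latter the inequality fails for φ = c·exp(−|x|²/2) of total mass below 1, and equality fails for Gaussians whose mass is not 1. *)

(* Defs.v *)
(* MathComp-Analysis; R^n is the type 'rV[R]_n of row vectors over a realType. *)
From HB Require Import structures.
From mathcomp Require Import all_boot all_order all_algebra.
From mathcomp Require Import all_classical all_reals all_analysis.

Set Implicit Arguments.
Unset Strict Implicit.
Unset Printing Implicit Defensive.

Import Order.TTheory GRing.Theory Num.Theory.
Import numFieldNormedType.Exports.

Local Open Scope classical_set_scope.
Local Open Scope ring_scope.

Fact measure_rV_display : measure_display.
Proof. exact: default_measure_display. Qed.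

(* The sigma-algebra generated by the coordinate maps, i.e. the Borel
   sigma-algebra of R^n; same construction as the library's n.-tuple T. *)
Section measurable_rV.
Context (R : realType) (n : nat).

Let coord : 'I_n -> 'rV[R]_n -> R := fun i v => v ord0 i.

Let rV_set0 : g_sigma_preimage coord set0.
Proof. exact: sigma_algebra0. Qed.

Let rV_setC A : g_sigma_preimage coord A -> g_sigma_preimage coord (~` A).
Proof. exact: sigma_algebraC. Qed.

Let rV_bigcup (F : (set 'rV[R]_n)^nat) :
  (forall i, g_sigma_preimage coord (F i)) ->
  g_sigma_preimage coord (\bigcup_i (F i)).
Proof. exact: sigma_algebra_bigcup. Qed.

HB.instance Definition _ := @isMeasurable.Build measure_rV_display
  'rV[R]_n (g_sigma_preimage coord) rV_set0 rV_setC rV_bigcup.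

Lemma measurable_coord (i : 'I_n) :
  measurable_fun [set: 'rV[R]_n] (fun v : 'rV[R]_n => v ord0 i).
Proof.
move=> _ Y mY; rewrite setTI; apply: sub_sigma_algebra => /=.
rewrite -bigcup_seq/=; exists i => /=; first by rewrite mem_index_enum.
by exists Y => //; rewrite setTI.
Qed.

End measurable_rV.

Section lebesgue_measure_rV.
Context (R : realType).

Definition rV_cons n (p : 'rV[R]_n * R) : 'rV[R]_n.+1 :=
  row_mx (p.2%:M : 'rV_1) p.1.

Lemma rV_cons0 n (p : 'rV[R]_n * R) : rV_cons p ord0 ord0 = p.2.
Proof.
have -> : (ord0 : 'I_n.+1) = lshift n (ord0 : 'I_1) by exact/val_inj.
by rewrite /rV_cons (row_mxEl (p.2%:M : 'rV_1) p.1) mxE.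
Qed.

Lemma rV_consS n (p : 'rV[R]_n * R) (j : 'I_n) :
  rV_cons p ord0 (lift ord0 j) = p.1 ord0 j.
Proof.
have -> : lift ord0 j = rshift 1 j by exact/val_inj.
by rewrite /rV_cons (row_mxEr (p.2%:M : 'rV_1) p.1).
Qed.

Lemma measurable_rV_cons n : measurable_fun [set: 'rV[R]_n * R] (@rV_cons n).
Proof.
apply: (@measurability _ _ _ _ _ _ (\big[setU/set0]_(i < n.+1)
  preimage_set_system setT (fun v : 'rV[R]_n.+1 => v ord0 i) measurable)) => //.
move=> _ [A + <-]; rewrite -bigcup_seq => -[i _ [Y mY <-]].
rewrite setTI [X in _ `&` X](_ : _ = (fun p => rV_cons p ord0 i) @^-1` Y)//.
have : measurable_fun [set: 'rV[R]_n * R] (fun p => rV_cons p ord0 i).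
  have [j ->|->] := unliftP ord0 i.
    under eq_fun do rewrite rV_consS.
    exact: (measurableT_comp (measurable_coord j) measurable_fst).
  under eq_fun do rewrite rV_cons0.
  exact: measurable_snd.
exact.
Qed.

(* n-dimensional Lebesgue measure: the n-fold product of lebesgue_measure,
   transported from 'rV_n * R to 'rV_n.+1 by rV_cons. *)
Fixpoint lebesgue_rV (n : nat) : {measure set 'rV[R]_n -> \bar R} :=
  match n with
  | 0 => dirac (0 : 'rV[R]_0)
  | m.+1 => measure_function_pushforward__canonical__measure_function_Measure
     (product_measure1 (lebesgue_rV m) (@lebesgue_measure R)) (@measurable_rV_cons m)
  end.

Lemma lebesgue_rV_box n (a b : 'rV[R]_n) :
  (forall i, a ord0 i <= b ord0 i) ->
  lebesgue_rV n [set v | forall i, a ord0 i <= v ord0 i <= b ord0 i] =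
  (\prod_(i < n) (b ord0 i - a ord0 i))%:E.
Proof.
elim: n => [|n IH] in a b * => ab.
  rewrite big_ord0 /= /dirac indicE mem_set//=.
  by case.
rewrite big_ord_recl /= /pushforward.
set a' : 'rV[R]_n := \row_(j < n) a ord0 (lift ord0 j).
set b' : 'rV[R]_n := \row_(j < n) b ord0 (lift ord0 j).
have -> : @rV_cons n @^-1`
    [set v | forall i, a ord0 i <= v ord0 i <= b ord0 i] =
  [set v : 'rV[R]_n | forall i, a' ord0 i <= v ord0 i <= b' ord0 i] `*`
  `[a ord0 ord0, b ord0 ord0]%classic.
  apply/seteqP; split => -[v x] /=.
    move=> h; split; last by have := h ord0; rewrite rV_cons0 in_itv.
    by move=> i; have := h (lift ord0 i); rewrite rV_consS !mxE.
  move=> [h]; rewrite in_itv /= => h0 i.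
  have [j ->|->] := unliftP ord0 i; last by rewrite rV_cons0.
  by rewrite rV_consS; have := h j; rewrite !mxE.
rewrite product_measure1E//; last first.
  rewrite [X in measurable X](_ : _ = \bigcap_(i in [set: 'I_n])
    ((fun v : 'rV[R]_n => v ord0 i) @^-1` `[a' ord0 i, b' ord0 i]%classic)).
    apply: fin_bigcap_measurable => // i _.
    by rewrite -[X in measurable X]setTI; exact: measurable_coord.
  apply/seteqP; split => v /= h i; first by move=> _; rewrite /= in_itv/=.
  by have := h i I; rewrite /= in_itv.
rewrite mulrC EFinM; congr (_ * _)%E.
  rewrite [LHS]IH; last by move=> i; rewrite !mxE.
  by congr _%:E; apply: eq_bigr => i _; rewrite !mxE.
rewrite [LHS]lebesgue_measure_itv/= lte_fin; case: ltP => // ba.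
suff -> : b ord0 ord0 = a ord0 ord0 by rewrite subrr.
by apply/eqP; rewrite eq_le ba ab.
Qed.

End lebesgue_measure_rV.

Section log_concave.
Context (R : realType) (n : nat).
Implicit Types (f phi : 'rV[R]_n -> R) (U : set 'rV[R]_n).

Definition dotp (u v : 'rV[R]_n) : R := \sum_(i < n) u ord0 i * v ord0 i.

Definition partial (i : 'I_n) f : 'rV[R]_n -> R := 'D_(delta_mx ord0 i) f.

Definition grad f (x : 'rV[R]_n) : 'rV[R]_n := \row_i partial i f x.

Definition hessian f (x : 'rV[R]_n) : 'M[R]_n :=
  \matrix_(i, j) partial i (partial j f) x.

Definition C2_on U f := forall x, U x ->
  {for x, continuous f} /\
  forall i, [/\ derivable f x (delta_mx ord0 i),
    {for x, continuous (partial i f)} &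
    forall j, derivable (partial i f) x (delta_mx ord0 j) /\
      {for x, continuous (partial j (partial i f))}].

Definition strictly_convex f := forall (x y : 'rV[R]_n) (t : R),
  x != y -> 0 < t -> t < 1 ->
  f (t *: x + (1 - t) *: y) < t * f x + (1 - t) * f y.

(* psi is finite everywhere, so that a log-concave function is positive. *)
Definition log_concave phi := exists psi : 'rV[R]_n -> R,
  convex_function [set: 'rV[R]_n] psi /\ forall x, phi x = expR (- psi x).

Definition supp phi : set 'rV[R]_n := [set x | 0 < phi x].

(* For phi > 0, the infimum of a nonempty set of reals bounded below by 0. *)
Definition dual phi (x : 'rV[R]_n) : R :=
  inf [set expR (- dotp x y) / phi y | y in [set: 'rV[R]_n]].

Definition normL1 phi : R := \int[lebesgue_rV R n]_x phi x.

(* The homogeneous (degree 1) form of the entropy: \int phi ln phi minus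
   |phi|_1 ln |phi|_1, which reduces to \int_(supp phi) phi ln phi when
   |phi|_1 = 1. With the second term dropped, the inequality
     \int phi ln det Hess(- ln phi) <=
     2 Ent(phi) + |phi|_1 ln (e^n (\int phi) (\int phi^o))
   is false: for phi = c exp(- |x|^2 / 2) its left-hand side is 0, and its
   right-hand side is 2 |phi|_1 ln |phi|_1 < 0 as soon as |phi|_1 < 1. *)
Definition Ent phi : R :=
  \int[lebesgue_rV R n]_(x in supp phi) (phi x * ln (phi x)) -
  normL1 phi * ln (normL1 phi).

Definition posdefmx (A : 'M[R]_n) :=
  A^T = A /\ forall x : 'rV[R]_n, x != 0 -> 0 < dotp (x *m A^T) x.

(* lne, with value -oo at 0, makes integrability in the last clause imply
   that the Hessian is nondegenerate almost everywhere. *)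
Definition standing_assumptions phi :=
  let psi x := - ln (phi x) in
  [/\ strictly_convex psi,
      C2_on (supp phi) phi,
      (lebesgue_rV R n).-integrable [set: 'rV[R]_n] (EFin \o phi),
      (lebesgue_rV R n).-integrable (supp phi) (EFin \o dual phi) &
      (lebesgue_rV R n).-integrable (supp phi) (fun x =>
        (phi x)%:E * lne (expR (dotp (grad phi x) x / phi x) *
                          phi x ^- 2 * \det (hessian psi x))%:E)%E].

End log_concave.

(* Main.v *)
From HB Require Import structures.
Require Import Defs.
From mathcomp Require Import all_boot all_order all_algebra.
From mathcomp Require Import all_classical all_reals all_analysis.
From mathcomp Require Import measurable_realfun.
From mathcomp Require Import ring lra.

(** Write phi = exp (- psi), T = grad psi, H = hessian psi, and let L be the
    Legendre transform of psi, so that dual phi = exp (- L).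

    Since L (T x) = <T x, x> - psi x, the argument E of the logarithm in the
    integrability assumption satisfies phi x * E x = dual phi (T x) * det (H x).
    The map T is injective, so the change of variables y = T x bounds the
    integral of the right-hand side by that of dual phi
    ([integral_dual_grad_le]), and Jensen's inequality, used in the form of the
    tangent line of ln ([tangent_bound]), turns this into a bound of the integral
    of phi ln E. Because ln E = ln det H - <T x, x> + 2 psi, it remains to bound
    the integral of phi <T x, x>, which is at most n times the integral of phi
    ([integral_phi_dot_grad_le]): formally it is minus the derivative at s = 1 of
    the integral of phi (s x), that is, of s^-n times the integral of phi.

    Change of variables. The inequality between the two integrals is obtained by
    measuring a set of pairs (x, y) in two ways. For r > 0 take the pairs for
    which psi - <y, .> attains its minimum within distance r of x. For a given y
    the minimiser is unique by strict convexity, so these x lie in a cube of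
    side 2 r; hence the integral of dual phi y over all these pairs is at most
    (2 r)^n times the integral of dual phi. For a given x with det (H x) != 0,
    put y = T x + r (k H): as r tends to 0, the minimiser of psi - <y, .> is x +
    r k up to o(r) ([local_surj]), so that every k in the open unit cube
    eventually gives an admissible pair, and dual phi y tends to dual phi (T x).
    Linear substitution in y ([integral_linear]) and Fatou's lemma, first in k
    and then in x, conclude. The linear substitution itself goes by induction on
    the dimension, eliminating one coordinate at a time with the Schur
    complement.

    Integrability. It all follows from midpoint log-concavity: integrating
    sqrt (phi x * phi y) <= phi ((x + y) / 2) in x shows first that sqrt phi is
    integrable (y = 0), then that it is bounded, so that phi ln phi is dominated
    by sqrt phi. The bound on phi <T x, x> is Fatou's lemma for the difference
    quotients of s -> phi (s x), which are bounded below by an integrable function.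

    Equality. For phi = C exp (- <A x, x>) the map T is linear, dual phi (T x) is
    phi x / C^2, and every integral reduces to that of phi. *)

Set Implicit Arguments.
Unset Strict Implicit.
Unset Printing Implicit Defensive.

Import Order.TTheory GRing.Theory Num.Theory.
Import numFieldNormedType.Exports.

Local Open Scope classical_set_scope.
Local Open Scope ring_scope.

(** * Lebesgue measure on row vectors *)

Lemma coord_norm_le (R : realType) n (v : 'rV[R]_n) i : `|v ord0 i| <= `|v|.
Proof.
rewrite [leRHS]mx_normrE; apply/bigmax_geP; right => /=.
by exists (ord0, i).
Qed.

Lemma rV_norm_le (R : realType) n (v : 'rV[R]_n) e :
  0 <= e -> (forall i, `|v ord0 i| <= e) -> `|v| <= e.
Proof.
move=> e0 h; rewrite [leLHS]mx_normrE; apply/bigmax_leP; split => //.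
by move=> [i j] _ /=; rewrite (ord1 i).
Qed.

Lemma rV_norm_lt (R : realType) n (v : 'rV[R]_n) e :
  0 < e -> (forall i, `|v ord0 i| < e) -> `|v| < e.
Proof.
move=> e0 h; rewrite [ltLHS]mx_normrE; apply/bigmax_ltP; split => //.
by move=> [i j] _ /=; rewrite (ord1 i).
Qed.

Lemma measurable_rV_box (R : realType) n (a b : 'rV[R]_n) :
  measurable [set v : 'rV[R]_n | forall i, a ord0 i <= v ord0 i <= b ord0 i].
Proof.
rewrite [X in measurable X](_ : _ = \bigcap_(i in [set: 'I_n])
    ((fun v : 'rV[R]_n => v ord0 i) @^-1` `[a ord0 i, b ord0 i]%classic)).
  apply: fin_bigcap_measurable => // i _.
  by rewrite -[X in measurable X]setTI; exact: measurable_coord.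
apply/seteqP; split => v /= h i; first by move=> _; rewrite /= in_itv/=.
by have := h i I; rewrite /= in_itv.
Qed.

Lemma sigma_finite_lebesgue_rV (R : realType) n :
  sigma_finite [set: 'rV[R]_n] (lebesgue_rV R n).
Proof.
pose c k : 'rV[R]_n := const_mx k%:R.
exists (fun k => [set v : 'rV[R]_n | forall i, (- c k) ord0 i <= v ord0 i <= c k ord0 i]).
  apply/esym/seteqP; split => // v _.
  have [k vk] : exists k : nat, `|v| <= k%:R.
    exists (Num.trunc `|v|).+1.
    exact/ltW/truncnS_gt.
  by exists k => // i; rewrite !mxE -ler_norml (le_trans (coord_norm_le v i)).
move=> k; split; first exact: measurable_rV_box.
rewrite [ltLHS]lebesgue_rV_box ?ltry// => i.
by rewrite !mxE -subr_ge0 opprK addr_ge0.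
Qed.

(** The measure [lebesgue_rV] as a constant of its own, so that the sigma-finite
    structure required by Fubini's theorem can be attached to it. *)
Definition leb (R : realType) n : set 'rV[R]_n -> \bar R := lebesgue_rV R n.
Arguments leb : clear implicits.

HB.instance Definition _ (R : realType) n :=
  Measure.copy (leb R n) (Measure.sort (lebesgue_rV R n)).

HB.instance Definition _ (R : realType) n := isSFinite.Build _ _ _ (leb R n)
  (sfinite_measure_sigma_finite (@sigma_finite_lebesgue_rV R n)).

HB.instance Definition _ (R : realType) n := isSigmaFinite.Build _ _ _ (leb R n)
  (@sigma_finite_lebesgue_rV R n).

Lemma measurable_fun_rV d (T : measurableType d) (R : realType) n
    (g : T -> 'rV[R]_n) :
  (forall i, measurable_fun setT (fun t => g t ord0 i)) -> measurable_fun setT g.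
Proof.
move=> mg; apply: (@measurability _ _ _ _ _ _ (\big[setU/set0]_(i < n)
  preimage_set_system setT (fun v : 'rV[R]_n => v ord0 i) measurable)) => //.
move=> _ [A + <-]; rewrite -bigcup_seq => -[i _ [Y mY <-]].
rewrite setTI [X in _ `&` X](_ : _ = (fun p => g p ord0 i) @^-1` Y)//.
exact: mg.
Qed.

Section fubini_rV.
Local Open Scope ereal_scope.
Context (R : realType) (n : nat) (f : 'rV[R]_n.+1 -> \bar R).
Hypotheses (mf : measurable_fun setT f) (f0 : forall x, 0 <= f x).

Let integral_pf : \int[leb R n.+1]_x f x =
  \int[product_measure1 (leb R n) (@lebesgue_measure R)]_p f (rV_cons p).
Proof.
transitivity (\int[pushforward (product_measure1 (leb R n) (@lebesgue_measure R))
   (@rV_cons R n)]_x f x) => //.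
by rewrite ge0_integral_pushforward//; exact: measurable_rV_cons.
Qed.

Lemma fubini_rV1 : \int[leb R n.+1]_x f x =
  \int[leb R n]_v \int[@lebesgue_measure R]_t f (rV_cons (v, t)).
Proof.
rewrite integral_pf.
apply: (@fubini_tonelli1 _ _ _ (measurableTypeR R) _ (leb R n) lebesgue_measure
  (fun p => f (rV_cons p))) => //.
exact: (measurableT_comp mf (@measurable_rV_cons R n)).
Qed.

Lemma fubini_rV2 : \int[leb R n.+1]_x f x =
  \int[@lebesgue_measure R]_t \int[leb R n]_v f (rV_cons (v, t)).
Proof.
rewrite integral_pf.
apply: (@fubini_tonelli2 _ _ _ (measurableTypeR R) _ (leb R n) lebesgue_measure
  (fun p => f (rV_cons p))) => //.
exact: (measurableT_comp mf (@measurable_rV_cons R n)).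
Qed.

End fubini_rV.

(** By uniqueness of Lebesgue measure it is enough to compare the two sides on
    the half-open intervals. *)
Lemma integral_affine1 (R : realType) (a b : R) (f : R -> \bar R) :
  0 < a -> measurable_fun setT f -> (forall t, 0 <= f t)%E ->
  (\int[lebesgue_measure]_t f t =
   a%:E * \int[lebesgue_measure]_t f ((a * t + b)%R))%E.
Proof.
move=> a0 mf f0.
pose g : measurableTypeR R -> measurableTypeR R := fun t => a * t + b.
have mg : measurable_fun setT g by apply: measurable_funD => //; exact: measurable_funM.
pose pf : {measure set (measurableTypeR R) -> \bar R} :=
  measure_function_pushforward__canonical__measure_function_Measure
    (@lebesgue_measure R) mg.
pose nu := mscale (NngNum (ltW a0)) pf.
have nuE A : measurable A -> lebesgue_measure A = nu A.
  apply: lebesgue_measure_unique => //= _ [[c d]] _ <-.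
  rewrite /nu /mscale /= /pushforward.
  have -> : g @^-1` `]c, d]%classic = `](c - b) / a, (d - b) / a]%classic.
    apply/seteqP; split => t; rewrite /g /= !in_itv/=.
      by move=> /andP[? ?]; rewrite ltr_pdivrMr// ler_pdivlMr//; apply/andP; split; lra.
    by rewrite ltr_pdivrMr// ler_pdivlMr// => /andP[? ?]; apply/andP; split; lra.
  rewrite !lebesgue_measure_itv/= !lte_fin ltr_pM2r ?invr_gt0// ltrD2r.
  case: ifPn => cd; last by rewrite mule0.
  by rewrite -!EFinB -EFinM; congr _%:E; field; rewrite gt_eqF.
transitivity (\int[nu]_t f t)%E.
  by apply: eq_measure_integral => A mA _; exact: nuE.
rewrite ge0_integral_mscale// /= ge0_integral_pushforward//.
Qed.

(** * Linear substitution *)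

Lemma dotp_rV_cons (R : realType) n (p q : 'rV[R]_n * R) :
  dotp (rV_cons p) (rV_cons q) = p.2 * q.2 + dotp p.1 q.1.
Proof.
rewrite /dotp big_ord_recl !rV_cons0; congr (_ + _).
by apply: eq_bigr => i _; rewrite !rV_consS.
Qed.

Lemma rV_cons_surj (R : realType) n (x : 'rV[R]_n.+1) : exists p, x = rV_cons p.
Proof.
exists (\row_j x ord0 (lift ord0 j), x ord0 ord0); apply/rowP => i.
by have [j ->|->] := unliftP ord0 i; rewrite ?rV_consS ?rV_cons0 //= mxE.
Qed.

Lemma rV_consD (R : realType) n (p q : 'rV[R]_n * R) :
  rV_cons p + rV_cons q = rV_cons (p.1 + q.1, p.2 + q.2).
Proof.
apply/rowP => i; rewrite mxE.
by have [j ->|->] := unliftP ord0 i; rewrite ?rV_consS ?rV_cons0 //= mxE.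
Qed.

Lemma measurable_mulmx (R : realType) n m (A : 'M[R]_(n, m)) j :
  measurable_fun setT (fun x : 'rV[R]_n => (x *m A) ord0 j).
Proof.
under eq_fun do rewrite mxE.
apply: measurable_sum => i; apply: measurable_funM => //.
exact: measurable_coord.
Qed.

Lemma measurable_affine (R : realType) n m (A : 'M[R]_(n, m)) (b : 'rV[R]_m) :
  measurable_fun setT (fun x : 'rV[R]_n => b + x *m A).
Proof.
apply: measurable_fun_rV => i; under eq_fun do rewrite mxE.
by apply: measurable_funD => //; exact: measurable_mulmx.
Qed.

(** Row vectors are written x = (t, v) with t the first coordinate; a is the
    pivot of A and [schur] the Schur complement of that pivot. The class of
    matrices with v -> <v A, v> positive is stable under this reduction. *)
Section schur.
Context (R : realType) (n : nat) (A : 'M[R]_(1 + n)).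
Hypothesis A0 : forall v : 'rV[R]_(1 + n), v != 0 -> 0 < dotp (v *m A) v.

Let a := A ord0 ord0.
Let b := ursubmx A.
Let c := dlsubmx A.
Let D := drsubmx A.
Definition schur : 'M[R]_n := D - a^-1 *: (c *m b).

Let ulE : ulsubmx A = a%:M.
Proof.
by apply/matrixP => i j; rewrite !ord1 !mxE mulr1n /a; congr (A _ _); exact/val_inj.
Qed.

Lemma mul_rV_cons (v : 'rV[R]_n) t : (rV_cons (v, t) : 'rV_(1 + n)) *m A =
  rV_cons (t *: b + v *m D, a * t + (v *m c) ord0 ord0).
Proof.
rewrite -[in LHS](submxK A) ulE /rV_cons /=.
rewrite (mul_row_block (t%:M : 'M[R]_1) v (a%:M : 'M[R]_1)) !mul_scalar_mx scale_scalar_mx.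
congr (row_mx _ _); apply/rowP => i; rewrite ord1.
by rewrite !mxE/= mulr1n mulrC.
Qed.

Lemma schur_pivot_gt0 : 0 < a.
Proof.
have := A0 (v := rV_cons (0, 1)); rewrite mul_rV_cons dotp_rV_cons/=.
rewrite mulr1 mul0mx mxE addr0 mulr1 /dotp.
rewrite [X in _ + X]big1 ?addr0; last by move=> i _; rewrite [X in _ * X]mxE mulr0.
apply; apply/eqP => /rowP/(_ ord0); rewrite rV_cons0/= mxE => /eqP.
by rewrite oner_eq0.
Qed.

Lemma schur_det : \det A = a * \det schur.
Proof.
have a0 := schur_pivot_gt0.
have -> : A = block_mx 1%:M 0 (a^-1 *: c) 1%:M *m block_mx a%:M b 0 schur.
  rewrite mulmx_block !mul1mx !mul0mx !addr0.
  rewrite -[LHS]submxK ulE; congr block_mx.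
    by rewrite mul_mx_scalar scalerA mulfV ?scale1r// gt_eqF.
  by rewrite /schur -scalemxAl addrC subrK.
by rewrite det_mulmx det_lblock det_ublock !det1 !mul1r det_scalar1.
Qed.

(** The first coordinate t completing w is chosen so that the first coordinate of
    (t, w) A vanishes; the form at (t, w) is then the form of the Schur complement
    at w. *)
Lemma schur_pos (w : 'rV[R]_n) : w != 0 -> 0 < dotp (w *m schur) w.
Proof.
move=> w0; have a0 := schur_pivot_gt0.
pose t := - a^-1 * (w *m c) ord0 ord0.
have := A0 (v := rV_cons (w, t)); rewrite mul_rV_cons dotp_rV_cons/=.
have -> : a * t + (w *m c) ord0 ord0 = 0.
  by rewrite /t mulrA mulrN mulfV ?gt_eqF// mulN1r addNr.
rewrite mul0r add0r.
have -> : t *: b + w *m D = w *m schur.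
  rewrite /schur mulmxBr addrC; congr (_ + _).
  rewrite -scalemxAr mulmxA [w *m c]mx11_scalar mul_scalar_mx scalerA /t.
  by rewrite mulNr scaleNr !mxE.
apply; apply: contra_neq w0 => /rowP h; apply/rowP => i.
by have := h (lift ord0 i); rewrite rV_consS/= !mxE.
Qed.

End schur.

(** For fixed v the first coordinate of b + (t, v) A is affine in t with slope the
    pivot, and expressing the other coordinates in terms of it leaves the Schur
    complement acting on v. One-dimensional substitution, an exchange of the two
    integrations and induction conclude. *)
Lemma integral_linear (R : realType) n (A : 'M[R]_n) :
  (forall v : 'rV[R]_n, v != 0 -> 0 < dotp (v *m A) v) ->
  0 < \det A /\ forall (b : 'rV[R]_n) (f : 'rV[R]_n -> \bar R),
    measurable_fun setT f -> (forall x, 0 <= f x)%E ->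
    (\int[leb R n]_x f x = (\det A)%:E * \int[leb R n]_x f (b + x *m A)%R)%E.
Proof.
elim: n A => [A _|n IH A A0].
  split; first by rewrite det_mx00.
  move=> b f mf f0; rewrite det_mx00 mul1e; apply: eq_integral => x _.
  by congr f; rewrite [LHS]thinmx0 [RHS]thinmx0.
have a0 := schur_pivot_gt0 A0.
have [S0 IHS] := IH _ (schur_pos A0).
have dA := schur_det A0.
split => [|b f mf f0]; first by rewrite dA mulr_gt0.
have [[b' b0] ->] := rV_cons_surj b.
set a := (A : 'M[R]_(1 + n)) ord0 ord0 in a0 dA.
pose ur := ursubmx (A : 'M[R]_(1 + n)); pose c := dlsubmx (A : 'M[R]_(1 + n)).
pose D := drsubmx (A : 'M[R]_(1 + n)).
have mT : measurable_fun setT (fun x : 'rV[R]_n.+1 => f (rV_cons (b', b0) + x *m A)).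
  exact: (measurableT_comp mf (measurable_affine A _)).
rewrite [in RHS]fubini_rV1//.
pose h (p : 'rV[R]_n * measurableTypeR R) : 'rV[R]_n.+1 :=
  rV_cons (b' + (a^-1 * (p.2 - b0 - (p.1 *m c) ord0 ord0)) *: ur + p.1 *m D, p.2).
have mh : measurable_fun setT h.
  have mc : measurable_fun setT
      (fun p : 'rV[R]_n * measurableTypeR R => (p.1 *m c) ord0 ord0).
    exact: (measurableT_comp (measurable_mulmx c ord0) measurable_fst).
  apply: measurable_fun_rV => i; have [j ->|->] := unliftP ord0 i.
    rewrite (_ : (fun p => _) = (fun p : 'rV[R]_n * measurableTypeR R => b' ord0 j +
        a^-1 * (p.2 - b0 - (p.1 *m c) ord0 ord0) * ur ord0 j + (p.1 *m D) ord0 j)).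
      2: by apply/funext => p; rewrite rV_consS [LHS]mxE [in LHS]mxE [in LHS]mxE.
    apply: measurable_funD.
      apply: measurable_funD => //.
      apply: measurable_funM => //; apply: measurable_funM => //.
      apply: measurable_funB => //; apply: measurable_funB => //.
    exact: (measurableT_comp (measurable_mulmx D j) measurable_fst).
  under eq_fun do rewrite rV_cons0/=.
  exact: measurable_snd.
have mfh : measurable_fun setT (f \o h) by exact: measurableT_comp.
have inner v : (\int[lebesgue_measure]_s f (h (v, s)) =
    a%:E * \int[lebesgue_measure]_t
      f (rV_cons (b', b0) + rV_cons (v, t) *m A)%R)%E.
  rewrite (@integral_affine1 _ a (b0 + (v *m c) ord0 ord0) (fun s => f (h (v, s))))//.
    congr (_ * _)%E; apply: eq_integral => t _; congr f.
    rewrite /h/= mul_rV_cons rV_consD/=; congr (rV_cons (_, _)).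
      rewrite -!addrA; congr (_ + (_ *: _ + _)).
      by rewrite -/a -/c; field; rewrite gt_eqF.
    by rewrite addrCA.
  exact: (measurableT_comp mfh).
have mrow s : measurable_fun setT (fun v : 'rV[R]_n => f (rV_cons (v, s))).
  apply: (measurableT_comp mf); apply: measurable_fun_rV => i.
  have [j ->|->] := unliftP ord0 i.
    by under eq_fun do rewrite rV_consS/=; exact: measurable_coord.
  rewrite (_ : (fun v => _) = cst s)//.
  by apply/funext => v; rewrite rV_cons0.
have outer s : (\int[leb R n]_v f (rV_cons (v, s)) =
    (\det (schur A))%:E * \int[leb R n]_v f (h (v, s)))%E.
  rewrite (IHS (b' + (a^-1 * (s - b0)) *: ur) (fun v => f (rV_cons (v, s))))//.
  congr (_ * _)%E; apply: eq_integral => v _; congr (f (rV_cons (_, _))).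
  have -> : v *m schur A = v *m D - (a^-1 * (v *m c) ord0 ord0) *: ur.
    rewrite /schur mulmxBr -/a -/ur -/c -/D -scalemxAr mulmxA.
    by rewrite [v *m c]mx11_scalar mul_scalar_mx scalerA !mxE.
  by rewrite /= (mulrBr _ (s - b0)) scalerBl !addrA [LHS]addrAC.
rewrite fubini_rV2//.
under eq_integral do rewrite outer.
rewrite ge0_integralZl//; last 3 first.
- exact: (@measurable_fun_fubini_tonelli_G _ _ _ (measurableTypeR R) _ (leb R n)
    (f \o h) mfh (fun=> f0 _)).
- by move=> s _; exact: integral_ge0.
- by rewrite lee_fin ltW.
rewrite -(@fubini_tonelli _ _ _ (measurableTypeR R) _ (leb R n) lebesgue_measure
  (f \o h) mfh (fun=> f0 _)).
rewrite dA EFinM -muleA muleCA; congr (_ * _)%E.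
under eq_integral do rewrite inner.
have mab : measurable_fun setT (fun p : 'rV[R]_n * measurableTypeR R =>
     f (rV_cons (b', b0) + rV_cons p *m A)).
  exact: (measurableT_comp mT (@measurable_rV_cons R n)).
rewrite ge0_integralZl//.
- exact: (@measurable_fun_fubini_tonelli_F _ _ _ (measurableTypeR R) _ lebesgue_measure
    _ mab (fun=> f0 _)).
- by move=> s _; exact: integral_ge0.
- by rewrite lee_fin ltW.
Qed.

(** * Functions with continuous partial derivatives *)

Section line_derivative.
Context (R : realType) (n : nat).
Implicit Types (f : 'rV[R]_n -> R) (x v : 'rV[R]_n).

Let line_quotient f x v t :
  (fun h : R => h^-1 *: (((fun s : R => f (x + s *: v)) \o shift t) (h *: (1 : R)) -
     f (x + t *: v))) =
  (fun h : R => h^-1 *: ((f \o shift (x + t *: v)) (h *: v) - f (x + t *: v))).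
Proof.
apply/funext => h /=; congr (_ *: (f _ - _)).
by rewrite [_ *: 1]mulr1 scalerDl addrCA.
Qed.

Lemma is_derive_line f x v t df : is_derive (x + t *: v) v f df ->
  is_derive t 1 (fun s : R => f (x + s *: v)) df.
Proof.
move=> [fd fE]; split; first by rewrite /derivable line_quotient.
by rewrite /derive line_quotient.
Qed.

Lemma line_is_derive f x v df : is_derive (0 : R) 1 (fun s : R => f (x + s *: v)) df ->
  is_derive x v f df.
Proof.
have e : x + 0 *: v = x by rewrite scale0r addr0.
move=> [fd fE]; split.
  by move: fd; rewrite /derivable line_quotient e.
by move: fE; rewrite /derive line_quotient e.
Qed.

End line_derivative.

Section calculus.
Context (R : realType) (n : nat).
Implicit Types (f : 'rV[R]_n -> R) (x h : 'rV[R]_n).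

Local Notation e_ i := (delta_mx ord0 i : 'rV[R]_n).

Lemma mvt_at0 (u du : R -> R) (s : R) : (forall t : R, is_derive t (1 : R) u (du t)) ->
  exists2 c, `|c| <= `|s| & u s - u 0 = du c * s.
Proof.
move=> ud.
have uc a b : {within `[a, b], continuous u}.
  apply: continuous_subspaceT => t; apply: differentiable_continuous.
  by apply/derivable1_diffP; have [] := ud t.
have [s0|s0|->] := ltgtP s 0.
- have [c] := MVT s0 (fun t _ => ud t) (uc _ _).
  rewrite in_itv/= => /andP[sc c0] E; exists c; first by rewrite !ltr0_norm// lerN2 ltW.
  by rewrite -opprB E sub0r mulrN opprK.
- have [c] := MVT s0 (fun t _ => ud t) (uc _ _).
  rewrite in_itv/= => /andP[sc c0] E; exists c; first by rewrite !gtr0_norm// ltW.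
  by rewrite E subr0.
- by exists 0 => //; rewrite subrr mulr0.
Qed.

Definition C1 f := forall x i, derivable f x (e_ i) /\
  {for x, continuous (partial i f)}.

Lemma C1_is_derive f x i : C1 f -> is_derive x (e_ i) f (partial i f x).
Proof. by move=> /(_ x i)[fd _]; split. Qed.

Lemma partial_mvt f x i (s : R) : C1 f ->
  exists2 c, `|c| <= `|s| & f (x + s *: e_ i) - f x = partial i f (x + c *: e_ i) * s.
Proof.
move=> f1; have [t|c cs E] := @mvt_at0 (fun t => f (x + t *: e_ i))
    (fun t => partial i f (x + t *: e_ i)) s.
  by apply: is_derive_line; exact: C1_is_derive.
by exists c => //; rewrite -E scale0r addr0.
Qed.

Let tr h k : 'rV[R]_n := \row_i (if (i < k)%N then h ord0 i else 0).

Let tr_norm h k : `|tr h k| <= `|h|.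
Proof.
apply: rV_norm_le => // i; rewrite mxE; case: ifP => // _; last by rewrite normr0.
exact: coord_norm_le.
Qed.

(** Passing from x to x + h one coordinate at a time, the mean value theorem
    writes each increment as a partial derivative at a point at distance at most
    2 |h| from x, where continuity makes it close to its value at x. *)
Lemma C1_expansion f x : C1 f -> forall e, 0 < e -> exists2 d, 0 < d &
  forall h, `|h| < d -> `|f (x + h) - f x - dotp (grad f x) h| <= e * `|h|.
Proof.
move=> f1 e e0.
have e'0 : 0 < e / n.+1%:R by rewrite divr_gt0.
have [d d0 dP] : exists2 d, 0 < d & forall h, `|h| < d -> forall i : 'I_n,
    `|partial i f (x + h) - partial i f x| <= e / n.+1%:R.
  have H (i : 'I_n) : \forall y \near x, `|partial i f x - partial i f y| < e / n.+1%:R.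
    by have [_ /cvgrPdist_lt/(_ _ e'0)] := f1 x i.
  have Hn : nbhs x (fun y => forall i : 'I_n,
      `|partial i f x - partial i f y| < e / n.+1%:R).
    by apply: (@filter_forall _ _ _ (nbhs x)) => i; exact: H.
  have /nbhs_ballP[d d0 dP] := Hn.
  exists d => // h hd i; rewrite distrC ltW//; apply: dP.
  by rewrite mx_norm_ball /ball_/= opprD addNKr normrN.
(* The intermediate points are at distance at most 2 |h| from x. *)
exists (d / 2); first by rewrite divr_gt0.
move=> h hd.
have step (k : 'I_n) : `|f (x + tr h k.+1) - f (x + tr h k) - partial k f x * h ord0 k| <=
    e / n.+1%:R * `|h|.
  have -> : x + tr h k.+1 = (x + tr h k) + h ord0 k *: e_ k.
    rewrite -addrA; congr (_ + _); apply/rowP => i; rewrite !mxE eqxx/=.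
    rewrite ltnS leq_eqVlt; have [ik|ik] := eqVneq i k.
      by rewrite ik eqxx ltnn/= mulr1 add0r.
    have -> : (i == k :> nat) = false by exact/negbTE.
    by rewrite /= mulr0 addr0.
  have [c cs ->] := partial_mvt (x + tr h k) k (h ord0 k) f1.
  rewrite -mulrBl normrM ler_pM// ?coord_norm_le// -addrA.
  apply: dP; apply: (@le_lt_trans _ _ (`|h| + `|h|)); last by lra.
  rewrite (le_trans (ler_normD _ _))// lerD// ?tr_norm//.
  apply: rV_norm_le => // i; rewrite !mxE eqxx/=.
  rewrite normrM (le_trans _ (le_trans cs (coord_norm_le _ _)))//.
  by rewrite ler_piMr//; case: eqP => _; rewrite ?normr1 ?normr0.
have -> : f (x + h) - f x - dotp (grad f x) h =
    \sum_(k < n) (f (x + tr h k.+1) - f (x + tr h k) - partial k f x * h ord0 k).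
  rewrite big_split/=; congr (_ + _); last first.
    by rewrite sumrN; congr (- _); apply: eq_bigr => i _; rewrite mxE.
  rewrite -(big_mkord xpredT (fun k => f (x + tr h k.+1) - f (x + tr h k))).
  rewrite telescope_sumr//; congr (f _ - f _).
    by congr (_ + _); apply/rowP => i; rewrite mxE ltn_ord.
  by rewrite -[LHS]addr0; congr (_ + _); apply/rowP => i; rewrite !mxE.
apply: (le_trans (ler_norm_sum _ _ _)).
apply: (le_trans (ler_sum _ (fun k _ => step k))).
rewrite sumr_const card_ord -[leLHS]mulr_natl mulrA ler_wpM2r//.
rewrite mulrCA ler_piMr ?(ltW e0)// ler_pdivrMr// mul1r ler_nat leqnSn//.
Qed.

Lemma dotp_norm_le (u v : 'rV[R]_n) : `|dotp u v| <= n%:R * `|u| * `|v|.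
Proof.
rewrite (le_trans (ler_norm_sum _ _ _))//.
apply: (@le_trans _ _ (\sum_(i < n) `|u| * `|v|)).
  by apply: ler_sum => i _; rewrite normrM ler_pM// coord_norm_le.
by rewrite sumr_const card_ord -[leLHS]mulr_natl mulrA.
Qed.

Lemma C1_continuous f : C1 f -> continuous f.
Proof.
move=> f1 x; apply/(@cvgrPdist_le _ _ _ (nbhs x) (nbhs_filter x)) => e e0.
have [d d0 dP] := C1_expansion x f1 ltr01.
pose M := n%:R * `|grad f x| + 1.
have M0 : 0 < M by rewrite ltr_wpDl// mulr_ge0.
have eM : 0 < e / M by rewrite divr_gt0.
apply/nbhs_ballP; exists (Num.min d (e / M)) => [|y]; first by rewrite /= lt_min d0.
rewrite mx_norm_ball /ball_/= distrC lt_min => /andP[hd /ltW he].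
have yx : y = x + (y - x) by rewrite addrC subrK.
rewrite distrC [in f y]yx.
rewrite -[X in `|X|](subrK (dotp (grad f x) (y - x))).
rewrite (le_trans (ler_normD _ _))//.
rewrite (le_trans (lerD (dP _ hd) (dotp_norm_le _ _)))//.
by rewrite -mulrDl addrC -ler_pdivlMl// mulrC.
Qed.

Lemma partialM f g x i : C1 f -> C1 g ->
  partial i (fun x => f x * g x) x = f x * partial i g x + g x * partial i f x.
Proof. by move=> f1 g1; apply: (deriveM (f1 x i).1 (g1 x i).1). Qed.

Lemma C1M f g : C1 f -> C1 g -> C1 (fun x => f x * g x).
Proof.
move=> f1 g1 x i; split; first exact: (derivableM (f1 x i).1 (g1 x i).1).
have -> : partial i (fun x => f x * g x) =
    (fun x => f x * partial i g x + g x * partial i f x).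
  by apply/funext => y; exact: partialM.
have [_ cf] := f1 x i; have [_ cg] := g1 x i.
exact: (continuousD (continuousM (C1_continuous f1 (x:=x)) cg)
  (continuousM (C1_continuous g1 (x:=x)) cf)).
Qed.

Lemma partialN f x i : C1 f -> partial i (fun x => - f x) x = - partial i f x.
Proof. by move=> f1; apply: (deriveN (f1 x i).1). Qed.

Lemma C1N f : C1 f -> C1 (fun x => - f x).
Proof.
move=> f1 x i; split; first exact: (derivableN (f1 x i).1).
have -> : partial i (fun x => - f x) = (fun x => - partial i f x).
  by apply/funext => y; exact: partialN.
by apply: continuousN; have [] := f1 x i.
Qed.

Lemma C1V f : (forall x, f x != 0) -> C1 f -> C1 (fun x => (f x)^-1).
Proof.
move=> f0 f1 x i; split; first exact: (derivableV (f0 x) (f1 x i).1).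
have -> : partial i (fun x => (f x)^-1) = (fun x => - (f x * f x)^-1 * partial i f x).
  by apply/funext => y; rewrite -expr2; apply: (deriveV (f0 y) (f1 y i).1).
apply: continuousM; last by have [] := f1 x i.
apply: continuousN; apply: continuousV; first by rewrite mulf_neq0.
by apply: continuousM; exact: C1_continuous.
Qed.

Lemma is_derive_ln_comp (u : R -> R) (d t : R) : 0 < u t ->
  is_derive t 1 u d -> is_derive t 1 (fun s => ln (u s)) (d * (u t)^-1).
Proof.
move=> ut [ud uE]; have [dl lE] := is_derive1_ln ut.
split.
  apply/derivable1_diffP; apply: (@differentiable_comp _ _ _ _ u (@ln R)).
    exact/derivable1_diffP.
  exact/derivable1_diffP.
rewrite -derive1E (_ : (fun s => ln (u s)) = @ln R \o u)// derive1_comp//.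
by rewrite !derive1E lE uE mulrC.
Qed.

Lemma partial_ln f x i : (forall x, 0 < f x) -> C1 f ->
  is_derive x (e_ i) (fun x => ln (f x)) (partial i f x * (f x)^-1).
Proof.
move=> f0 f1; apply: line_is_derive.
have fx : f (x + 0 *: e_ i) = f x by rewrite scale0r addr0.
rewrite -[in (f x)^-1]fx.
apply: (@is_derive_ln_comp (fun s : R => f (x + s *: e_ i))); first exact: f0.
by apply: is_derive_line; rewrite scale0r addr0; exact: C1_is_derive.
Qed.

Lemma C1_ln f : (forall x, 0 < f x) -> C1 f -> C1 (fun x => ln (f x)).
Proof.
move=> f0 f1 x i; split; first by have [] := partial_ln x i f0 f1.
have -> : partial i (fun x => ln (f x)) = (fun x => partial i f x * (f x)^-1).
  by apply/funext => y; have [] := partial_ln y i f0 f1.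
apply: continuousM; first by have [] := f1 x i.
by apply: continuousV; [rewrite gt_eqF|exact: C1_continuous].
Qed.

Definition C2 f := C1 f /\ forall i, C1 (partial i f).

Lemma C2_ln f : (forall x, 0 < f x) -> C2 f -> C2 (fun x => - ln (f x)).
Proof.
move=> f0 [f1 f2]; split; first exact/C1N/C1_ln.
move=> i.
have -> : partial i (fun x => - ln (f x)) = (fun x => - (partial i f x * (f x)^-1)).
  apply/funext => y; rewrite partialN; last exact: C1_ln.
  by congr (- _); have [] := partial_ln y i f0 f1.
by apply: C1N; apply: C1M => //; apply: C1V => // y; rewrite gt_eqF.
Qed.

Lemma partial_Nln f x i : (forall x, 0 < f x) -> C1 f ->
  partial i (fun x => - ln (f x)) x = - (partial i f x / f x).
Proof.
move=> f0 f1; rewrite partialN; last exact: C1_ln.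
by congr (- _); have [] := partial_ln x i f0 f1.
Qed.

(** The mean value theorem in direction i, then in direction j. The left-hand side
    is symmetric in i and j, which gives [partialC]. *)
Lemma double_difference f x i j (s : R) : C2 f ->
  exists2 h, `|h| <= `|s| + `|s| &
  (f (x + s *: e_ j + s *: e_ i) - f (x + s *: e_ i)) - (f (x + s *: e_ j) - f x) =
    partial j (partial i f) (x + h) * s * s.
Proof.
move=> [f1 f2].
have e1 k (c : R) : `|c *: e_ k| <= `|c|.
  apply: rV_norm_le => // l; rewrite !mxE eqxx/= normrM ler_piMr//.
  by case: eqP => _; rewrite ?normr1 ?normr0.
have [t|c cs] := @mvt_at0 (fun t => f (x + s *: e_ j + t *: e_ i) - f (x + t *: e_ i))
   (fun t => partial i f (x + s *: e_ j + t *: e_ i) - partial i f (x + t *: e_ i)) s.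
  by apply: is_deriveB; apply: is_derive_line; exact: C1_is_derive.
rewrite scale0r !addr0 => ->.
rewrite addrAC; have [c' cs' ->] := partial_mvt (x + c *: e_ i) j s (f2 i).
exists (c *: e_ i + c' *: e_ j); last by rewrite addrA.
by rewrite (le_trans (ler_normD _ _))// lerD// (le_trans (e1 _ _)).
Qed.

Lemma eq_of_mul_eq (a b p q s : R) : s != 0 -> a = p * s * s -> b = q * s * s ->
  a = b -> p = q.
Proof. by move=> s0 -> -> /(mulIf s0)/(mulIf s0). Qed.

Lemma dist_le_half (p q r e : R) : `|q - p| < e / 2 -> `|r - p| < e / 2 ->
  `|q - r| <= e.
Proof.
move=> A B; rewrite (le_trans (ler_distD p _ _))// [leRHS]splitr.
by rewrite lerD// ltW// distrC.
Qed.

Lemma partialC f x i j : C2 f -> partial i (partial j f) x = partial j (partial i f) x.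
Proof.
move=> f2; apply/eqP; rewrite -subr_eq0 -normr_eq0 eq_le normr_ge0 andbT.
apply/ler_addgt0Pl => e e0; rewrite addr0.
have e2 : 0 < e / 2 by rewrite divr_gt0.
have near_x a b : exists2 d, 0 < d & forall h, `|h| < d ->
    `|partial a (partial b f) x - partial a (partial b f) (x + h)| < e / 2.
  have [_ /cvgrPdist_lt/(_ _ e2)/nbhs_ballP[d d0 dP]] := f2.2 b x a.
  exists d => // h hd; apply: dP.
  by rewrite mx_norm_ball /ball_/= opprD addNKr normrN.
have [d1 d10 d1P] := near_x i j; have [d2 d20 d2P] := near_x j i.
pose s := Num.min d1 d2 / 4.
have s0 : 0 < s by rewrite divr_gt0// lt_min d10.
have [h hs E1] := double_difference x i j s f2.
have [k ks E2] := double_difference x j i s f2.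
have : partial j (partial i f) (x + h) = partial i (partial j f) (x + k).
  by apply: (eq_of_mul_eq _ E1 E2); rewrite ?gt_eqF// (addrAC x); ring.
have sm : `|s| + `|s| < Num.min d1 d2.
  have m0 : 0 < Num.min d1 d2 by rewrite lt_min d10.
  by rewrite (gtr0_norm s0) /s; move: (Num.min d1 d2) m0; clear=> m m0; lra.
have hd2 : `|h| < d2 by rewrite (le_lt_trans hs)// (lt_le_trans sm)// ge_min lexx orbT.
have kd1 : `|k| < d1 by rewrite (le_lt_trans ks)// (lt_le_trans sm)// ge_min lexx.
move: (d1P _ kd1) (d2P _ hd2) => A B E; rewrite E in B.
exact: (dist_le_half A B).
Qed.

End calculus.

(** * Scalar product and coercivity *)

Section dotp_theory.
Context (R : realType) (n : nat).
Implicit Types (u v w : 'rV[R]_n).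

Lemma dotpDl u v w : dotp (u + v) w = dotp u w + dotp v w.
Proof. by rewrite -big_split; apply: eq_bigr => i _; rewrite mxE mulrDl. Qed.

Lemma dotpC u v : dotp u v = dotp v u.
Proof. by apply: eq_bigr => i _; rewrite mulrC. Qed.

Lemma dotpDr u v w : dotp u (v + w) = dotp u v + dotp u w.
Proof. by rewrite dotpC dotpDl !(dotpC u). Qed.

Lemma dotpZl a u v : dotp (a *: u) v = a * dotp u v.
Proof. by rewrite mulr_sumr; apply: eq_bigr => i _; rewrite mxE mulrA. Qed.

Lemma dotpZr a u v : dotp u (a *: v) = a * dotp u v.
Proof. by rewrite dotpC dotpZl dotpC. Qed.

Lemma dotpNl u v : dotp (- u) v = - dotp u v.
Proof. by rewrite -scaleN1r dotpZl mulN1r. Qed.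

Lemma dotpNr u v : dotp u (- v) = - dotp u v.
Proof. by rewrite dotpC dotpNl dotpC. Qed.

Lemma dotpBl u v w : dotp (u - v) w = dotp u w - dotp v w.
Proof. by rewrite dotpDl dotpNl. Qed.

Lemma dotpBr u v w : dotp u (v - w) = dotp u v - dotp u w.
Proof. by rewrite dotpDr dotpNr. Qed.

Lemma dotp_delta u i : dotp u (delta_mx ord0 i) = u ord0 i.
Proof.
rewrite /dotp (bigD1 i)//= big1 ?addr0 => [|j ji]; first by rewrite mxE !eqxx mulr1.
by rewrite mxE eqxx/= (negbTE ji) mulr0.
Qed.

Lemma dotp_sqr_ge u : `|u| ^+ 2 <= dotp u u.
Proof.
have [->|u0] := eqVneq u 0.
  by rewrite normr0 expr0n; apply: sumr_ge0 => i _; rewrite mxE mulr0.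
have : `|u| != 0 by rewrite normr_eq0.
move=> /mx_norm_neq0[[i j] /= E].
rewrite (_ : `|u| = `|u ord0 j|); last by rewrite [LHS]E (ord1 i).
rewrite real_normK ?num_real// /dotp (bigD1 j)//= expr2 lerDl.
by apply: sumr_ge0 => k _; rewrite -expr2 sqr_ge0.
Qed.

Lemma dotp_mulmx_tr u v (A : 'M[R]_n) : dotp (u *m A) v = dotp u (v *m A^T).
Proof.
have dE a b : dotp a b = (a *m b^T) ord0 ord0.
  by rewrite mxE; apply: eq_bigr => i _; rewrite mxE.
by rewrite !dE trmx_mul trmxK mulmxA.
Qed.

Lemma lipschitz_continuous (f : 'rV[R]_n -> R) M :
  (forall x y, `|f x - f y| <= M * `|x - y|) -> continuous f.
Proof.
move=> fM x; apply/(@cvgrPdist_le _ _ _ (nbhs x) (nbhs_filter x)) => e e0.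
have M0 : 0 < `|M| + 1 by rewrite ltr_wpDl.
apply/nbhs_ballP; exists (e / (`|M| + 1)) => [|y]; first by rewrite /= divr_gt0.
rewrite mx_norm_ball /ball_/= ltr_pdivlMr// => /ltW h.
rewrite (le_trans (fM _ _))// (le_trans _ h)// mulrC ler_wpM2l//.
by rewrite (le_trans (ler_norm _))// lerDl.
Qed.

Lemma continuous_dotp u : continuous (dotp u).
Proof.
apply: (@lipschitz_continuous _ (n%:R * `|u|)) => x y.
by rewrite -dotpBr dotp_norm_le.
Qed.

Lemma continuous_sum (I : Type) (r : seq I) (f : I -> 'rV[R]_n -> R) :
  (forall i, continuous (f i)) -> continuous (fun v => \sum_(i <- r) f i v).
Proof.
move=> cf; elim: r => [|i r IH].
  have -> : (fun v => \sum_(i <- [::]) f i v) = cst 0.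
    by apply/funext => v; rewrite big_nil.
  exact: cst_continuous.
have -> : (fun v => \sum_(j <- i :: r) f j v) = (fun v => f i v + \sum_(j <- r) f j v).
  by apply/funext => v; rewrite big_cons.
by move=> v; apply: continuousD; [exact: cf|exact: IH].
Qed.

Lemma compact_unit_ball : compact [set v : 'rV[R]_n | `|v| <= 1].
Proof.
apply: bounded_closed_compact.
  by exists 1; split=> // y y1 x /= xle; rewrite (le_trans xle (ltW y1)).
rewrite (_ : [set _ | _] = Num.norm @^-1` [set x : R | x <= 1])//.
by apply: closed_comp => // v _; exact: norm_continuous.
Qed.

(** The constant is the minimum of the form on the unit sphere. *)
Lemma posdef_coercive (A : 'M[R]_n) :
  (forall v : 'rV[R]_n, v != 0 -> 0 < dotp (v *m A) v) ->
  exists2 c, 0 < c & forall v, c * `|v| ^+ 2 <= dotp (v *m A) v.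
Proof.
move=> A0; pose S := [set v : 'rV[R]_n | `|v| = 1].
have [S0|/set0P S0] := eqVneq S set0.
  exists 1 => // v; have [->|v0] := eqVneq v 0.
    by rewrite mul0mx normr0 expr0n mulr0; apply: sumr_ge0 => i _; rewrite mxE mulr0.
  have : S (`|v|^-1 *: v).
    by rewrite /S/= normrZ normfV normr_id mulVf// normr_eq0.
  by rewrite S0.
have cS : compact S.
  apply: (subclosed_compact _ compact_unit_ball); last by move=> v /= ->.
  rewrite (_ : S = Num.norm @^-1` [set x : R | x = 1])//.
  by apply: closed_comp => // v _; exact: norm_continuous.
have cq : continuous (fun v : 'rV[R]_n => dotp (v *m A) v).
  apply: (@continuous_sum _ _ (fun i (w : 'rV[R]_n) => (w *m A) ord0 i * w ord0 i)) => i.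
  have c1 : continuous (fun w : 'rV[R]_n => (w *m A) ord0 i).
    rewrite (_ : (fun w : 'rV[R]_n => _) = dotp (row i A^T)); first exact: continuous_dotp.
    by apply/funext => w; rewrite mxE; apply: eq_bigr => j _; rewrite !mxE mulrC.
  by move=> v; apply: continuousM; [exact: c1|exact: coord_continuous].
have [v /set_mem Sv vmin] := EVT_min_rV S0 cS (continuous_subspaceT cq).
have v0 : v != 0 by rewrite -normr_eq0 Sv oner_eq0.
exists (dotp (v *m A) v); first exact: A0.
move=> w; have [->|w0] := eqVneq w 0.
  by rewrite mul0mx normr0 expr0n mulr0; apply: sumr_ge0 => i _; rewrite mxE mulr0.
have Nw : 0 < `|w| by rewrite normr_gt0.
have : dotp (v *m A) v <= dotp ((`|w|^-1 *: w) *m A) (`|w|^-1 *: w).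
  by apply: vmin; rewrite inE /S/= normrZ normfV normr_id mulVf// gt_eqF.
rewrite -scalemxAl dotpZl dotpZr mulrA -expr2 exprVn mulrC ler_pdivlMr ?exprn_gt0//.
Qed.

End dotp_theory.

(** Removes the error terms left by first-order expansions. *)
Lemma ge0_of_eps (R : realType) (a b : R) : (forall e, 0 < e -> - (e * b) <= a) -> 0 <= a.
Proof.
move=> h; rewrite leNgt; apply/negP => a0.
have b0 : 0 < `|b| + 1 by rewrite ltr_wpDl.
have := h (- a / (2 * (`|b| + 1))).
rewrite divr_gt0 ?oppr_gt0 ?mulr_gt0// => /(_ isT); apply/negP; rewrite -ltNge.
rewrite ltrNr (@le_lt_trans _ _ (- a / (2 * (`|b| + 1)) * (`|b| + 1)))//.
  rewrite ler_pM2l ?divr_gt0 ?oppr_gt0 ?mulr_gt0//.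
  by rewrite (le_trans (ler_norm b))// lerDl.
have -> : - a / (2 * (`|b| + 1)) * (`|b| + 1) = - a / 2.
  by field; rewrite gt_eqF.
by move: a0; clear; lra.
Qed.

(** * Gradients and Hessians of strictly convex functions *)

Section convex.
Context (R : realType) (n : nat) (psi : 'rV[R]_n -> R).
Hypotheses (psi2 : C2 psi) (psi_sc : strictly_convex psi).

Let T := grad psi.
Let H := hessian psi.

Lemma convex_segment x d t : 0 <= t <= 1 ->
  psi (x + t *: d) <= psi x + t * (psi (x + d) - psi x).
Proof.
move=> /andP[]; rewrite le_eqVlt => /predU1P[<- _|t0].
  by rewrite scale0r mul0r !addr0.
rewrite le_eqVlt => /predU1P[->|t1].
  by rewrite scale1r mul1r [leRHS]addrC subrK.
have [->|d0] := eqVneq d 0; first by rewrite scaler0 addr0 subrr mulr0 addr0.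
have /(psi_sc)/(_ t0 t1) : x + d != x by rewrite -subr_eq0 addrC addKr.
have -> : t *: (x + d) + (1 - t) *: x = x + t *: d.
  by apply/rowP => i; rewrite !mxE; ring.
by move=> /ltW/le_trans; apply; move: (psi (x + d)) (psi x) => a b; lra.
Qed.

(** [C1_expansion] along a ray, with an error proportional to t. *)
Lemma directional_expansion x d e : 0 < e ->
  exists2 t0, 0 < t0 & forall t, 0 < t -> t < t0 ->
    `|psi (x + t *: d) - psi x - t * dotp (T x) d| <= t * (e * `|d|).
Proof.
move=> e0; have [r r0 rP] := C1_expansion x psi2.1 e0.
exists (r / (`|d| + 1)); first by rewrite divr_gt0// ltr_wpDl.
move=> t t0; rewrite ltr_pdivlMr ?ltr_wpDl// => tr.
have := rP (t *: d); rewrite normrZ (gtr0_norm t0) dotpZr mulrCA; apply.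
by rewrite (le_lt_trans _ tr)// ler_pM2l// lerDl.
Qed.

(** The variational inequality at a minimum over a convex set: only directions d
    pointing into the set are tested. *)
Lemma first_order_condition z y d :
  (forall t, 0 < t <= 1 -> psi z - dotp y z <= psi (z + t *: d) - dotp y (z + t *: d)) ->
  0 <= dotp (T z - y) d.
Proof.
move=> h; apply: (@ge0_of_eps _ _ `|d|) => e e0.
have [t0 t00 tP] := directional_expansion z d e0.
pose t := Num.min t0 1 / 2.
have m0 : 0 < Num.min t0 1 by rewrite lt_min t00 ltr01.
have tp : 0 < t by rewrite divr_gt0.
have tm : t < Num.min t0 1 by rewrite /t ltr_pdivrMr// ltr_pMr// ltr1n.
have [tt0 t1] : t < t0 /\ t < 1 by apply/andP; rewrite -lt_min.
have := h t; rewrite tp ltW// => /(_ isT); rewrite dotpDr dotpZr.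
have := tP _ tp tt0; rewrite ler_norml => /andP[_].
rewrite dotpBl => A B; rewrite -(ler_pM2l tp); move: A B.
move: (psi (z + t *: d)) (dotp y z) (dotp (T z) d) (dotp y d) (psi z) => a b c f g.
move: (e * `|d|) => k; nra.
Qed.

Lemma grad_ineq x y : psi x + dotp (T x) (y - x) <= psi y.
Proof.
rewrite -subr_ge0; apply: (@ge0_of_eps _ _ `|y - x|) => e e0.
have [t0 t00 tP] := directional_expansion x (y - x) e0.
pose t := Num.min t0 1 / 2.
have m0 : 0 < Num.min t0 1 by rewrite lt_min t00 ltr01.
have tp : 0 < t by rewrite divr_gt0.
have tm : t < Num.min t0 1 by rewrite /t ltr_pdivrMr// ltr_pMr// ltr1n.
have [tt0 t1] : t < t0 /\ t < 1 by apply/andP; rewrite -lt_min.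
have := @convex_segment x (y - x) t; rewrite (ltW tp) (ltW t1) => /(_ isT).
rewrite [x + (y - x)]addrC subrK => A.
have := tP _ tp tt0; rewrite ler_norml => /andP[B _].
rewrite -(ler_pM2l tp); move: A B.
move: (psi (x + t *: (y - x))) (dotp (T x) (y - x)) (psi x) (psi y) => a b c f.
by move: (e * `|y - x|) => k; nra.
Qed.

Lemma grad_mono x y : 0 <= dotp (T y - T x) (y - x).
Proof.
have := lerD (grad_ineq x y) (grad_ineq y x).
rewrite -[in X in psi x + _ + X]opprB dotpNr dotpBl.
by move: (dotp (T y) _) (dotp (T x) _) (psi x) (psi y) => a b c d; lra.
Qed.

Lemma grad_expansion x e : 0 < e -> exists2 d, 0 < d & forall h, `|h| < d ->
  `|T (x + h) - T x - h *m H x| <= e * `|h|.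
Proof.
move=> e0.
have near_x (j : 'I_n) : nbhs (0 : 'rV[R]_n) (fun h =>
    `|partial j psi (x + h) - partial j psi x - dotp (grad (partial j psi) x) h| <=
    e * `|h|).
  have [d d0 dP] := C1_expansion x (psi2.2 j) e0.
  apply/nbhs_ballP; exists d => // h.
  by rewrite mx_norm_ball /ball_/= sub0r normrN; exact: dP.
have Hn : nbhs (0 : 'rV[R]_n) (fun h => forall j : 'I_n,
    `|partial j psi (x + h) - partial j psi x - dotp (grad (partial j psi) x) h| <=
    e * `|h|).
  by apply: (@filter_forall _ _ _ (nbhs (0 : 'rV[R]_n))) => i; exact: near_x.
have /nbhs_ballP[d d0 dP] := Hn.
exists d => // h hd; apply: rV_norm_le => [|j]; first by rewrite mulr_ge0// ltW.
have := dP h; rewrite mx_norm_ball /ball_/= sub0r normrN => /(_ hd j).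
congr (`| _ | <= _); rewrite !mxE; congr (_ - _).
by apply: eq_bigr => i _; rewrite !mxE mulrC.
Qed.

Lemma hessian_sym x : (H x)^T = H x.
Proof. by apply/matrixP => i j; rewrite !mxE partialC. Qed.

Lemma hessian_psd x v : 0 <= dotp (v *m H x) v.
Proof.
apply: (@ge0_of_eps _ _ (n%:R * `|v| * `|v|)) => e e0.
have [d d0 dP] := grad_expansion x e0.
pose t := d / (`|v| + 1) / 2.
have v0 : 0 < `|v| + 1 by rewrite ltr_wpDl.
have tp : 0 < t by rewrite !divr_gt0.
have tv : `|t *: v| < d.
  rewrite normrZ gtr0_norm// (@le_lt_trans _ _ (t * (`|v| + 1)))//.
    by rewrite ler_pM2l// lerDl.
  rewrite (_ : _ * _ = d / 2); last by rewrite /t; field; rewrite gt_eqF.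
  by rewrite ltr_pdivrMr// ltr_pMr// ltr1n.
have := dP _ tv; set r := _ - _ *m _ => rle.
have := grad_mono x (x + t *: v); rewrite addrAC subrr add0r.
rewrite (_ : T _ - T x = r + (t *: v) *m H x); last by rewrite /r subrK.
rewrite dotpDl -scalemxAl dotpZl !dotpZr.
have := dotp_norm_le r v; rewrite ler_norml => /andP[_ A].
have B : n%:R * `|r| * `|v| <= n%:R * (e * (t * `|v|)) * `|v|.
  rewrite ler_wpM2r// ler_wpM2l// (le_trans rle)// normrZ gtr0_norm//.
rewrite -mulrDr pmulr_rge0// => C.
rewrite -(ler_pM2l tp).
move: A B C; rewrite (_ : n%:R * (e * (t * `|v|)) * `|v| = t * (e * (n%:R * `|v| * `|v|))); last by ring.
move: (dotp r v) (dotp _ v) (n%:R * `|r| * `|v|) (e * _) => a b c f.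
lra.
Qed.

(** A null vector v of a positive semidefinite symmetric form is orthogonal to
    every w, as the form at v + t w is nonnegative for all t; so v lies in the
    kernel of the Hessian. *)
Lemma hessian_posdef x : \det (H x) != 0 ->
  forall v : 'rV[R]_n, v != 0 -> 0 < dotp (v *m H x) v.
Proof.
move=> dH v v0; rewrite lt_neqAle hessian_psd andbT eq_sym.
apply: contra_neq v0 => vH0.
have orth w : dotp (v *m H x) w = 0.
  have q t : 0 <= 2 * t * dotp (v *m H x) w + t ^+ 2 * dotp (w *m H x) w.
    have := hessian_psd x (v + t *: w).
    rewrite mulmxDl -scalemxAl !(dotpDl, dotpDr, dotpZl, dotpZr) vH0 add0r.
    rewrite (dotp_mulmx_tr w v) hessian_sym (dotpC w) => /le_trans; apply.
    by rewrite le_eqVlt; apply/orP; left; apply/eqP; ring.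
  move: (dotp (v *m H x) w) (dotp (w *m H x) w) (hessian_psd x w) q => a b b0 q.
  have b1 : 0 < b + 1 by rewrite ltr_wpDl.
  (* The minimum over t is at - a / b; the shift b + 1 covers b = 0. *)
  have := q (- a / (b + 1)).
  have -> : 2 * (- a / (b + 1)) * a + (- a / (b + 1)) ^+ 2 * b =
    - (a ^+ 2 * (b + 2) / (b + 1) ^+ 2) by field; rewrite gt_eqF.
  rewrite oppr_ge0 => h.
  have : a ^+ 2 * (b + 2) / (b + 1) ^+ 2 = 0.
    apply/eqP; rewrite eq_le h/= divr_ge0 ?sqr_ge0// mulr_ge0 ?sqr_ge0//.
    by rewrite addr_ge0.
  have b2 : b + 2 != 0 by rewrite gt_eqF// ltr_wpDl.
  have b3 : (b + 1) ^+ 2 != 0 by rewrite expf_neq0// gt_eqF.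
  move=> /eqP; rewrite mulf_eq0 invr_eq0 (negbTE b3) orbF.
  by rewrite mulf_eq0 (negbTE b2) orbF sqrf_eq0 => /eqP.
have vH : v *m H x = 0.
  by apply/rowP => i; rewrite -dotp_delta orth mxE.
have Hu : H x \in unitmx by rewrite unitmxE unitfE.
by rewrite -(mulmxK Hu v) vH mul0mx.
Qed.

Lemma continuous_tilted y x r :
  continuous (fun h : 'rV[R]_n => psi (x + r *: h) - dotp y (x + r *: h)).
Proof.
have ca : continuous (fun h : 'rV[R]_n => x + r *: h).
  move=> h; apply: (@continuousD _ _ _ (fun=> x) (fun h : 'rV[R]_n => r *: h)).
    exact: cst_continuous.
  exact: scaler_continuous.
move=> h; apply: (@continuousB _ _ _ (fun h : 'rV[R]_n => psi (x + r *: h))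
  (fun h : 'rV[R]_n => dotp y (x + r *: h))).
  exact: (continuous_comp (ca h) (C1_continuous psi2.1 (x:=_))).
exact: (continuous_comp (ca h) (@continuous_dotp _ _ y _)).
Qed.

(** Two minimisers would make the value at their midpoint smaller. *)
Lemma strict_min_unique y z z' :
  (forall w, psi z - dotp y z <= psi w - dotp y w) ->
  (forall w, psi z' - dotp y z' <= psi w - dotp y w) -> z = z'.
Proof.
move=> zm z'm; apply/eqP; apply: contraT => zz'.
have h0 : 0 < 2^-1 :> R by rewrite invr_gt0.
have h1 : 2^-1 < 1 :> R by rewrite invf_lt1// ltr1n.
have := psi_sc zz' h0 h1; set w := _ + _ => ps.
have := zm w; have := zm z'; have := z'm z.
rewrite {2}/w dotpDr !dotpZr; move: ps.
by move: (psi z) (psi z') (dotp y z) (dotp y z') (psi w) => a b c d e; lra.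
Qed.

(** Let h minimise psi (x + r h) - <y, x + r h> over the closed unit cube. The
    variational inequality tested against k, together with
    T (x + r h) = T x + r (h H) + o(r), gives <(h - k) H, h - k> <= o(1) |h - k|.
    Coercivity then puts h close to k, hence in the interior of the cube, and by
    convexity an interior local minimum is global. *)
Lemma local_surj x (k : 'rV[R]_n) : \det (H x) != 0 -> `|k| < 1 ->
  exists2 d, 0 < d & forall r, 0 < r < d -> exists2 h : 'rV[R]_n, `|h| < 1 &
    let y := T x + r *: (k *m H x) in
    forall w, psi (x + r *: h) - dotp y (x + r *: h) <= psi w - dotp y w.
Proof.
move=> dH k1; have [c c0 cP] := posdef_coercive (hessian_posdef dH).
pose n1 : R := n%:R + 1.
have n10 : 0 < n1 by rewrite ltr_wpDl.
(* This e makes |h - k| < 1 - |k| below. *)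
pose e := c * (1 - `|k|) / n1.
have e0 : 0 < e by rewrite divr_gt0// mulr_gt0// subr_gt0.
have [d d0 dP] := grad_expansion x e0.
exists d => // r /andP[r0 rd].
pose y := T x + r *: (k *m H x).
have B0 : [set v : 'rV[R]_n | `|v| <= 1] !=set0 by exists 0; rewrite /= normr0.
have [h /set_mem/= hB hmin] := EVT_min_rV B0 (@compact_unit_ball R n)
  (continuous_subspaceT (@continuous_tilted y x r)).
have {}hmin v : `|v| <= 1 ->
    psi (x + r *: h) - dotp y (x + r *: h) <= psi (x + r *: v) - dotp y (x + r *: v).
  by move=> v1; apply: hmin; rewrite inE.
have interp v t : `|v| <= 1 -> 0 < t <= 1 -> `|h + t *: (v - h)| <= 1.
  move=> v1 /andP[t0 t1].
  rewrite (_ : _ + _ = t *: v + (1 - t) *: h); last first.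
    by apply/rowP => i; rewrite !mxE; ring.
  rewrite (le_trans (ler_normD _ _))// !normrZ gtr0_norm// ger0_norm ?subr_ge0//.
  rewrite -[leRHS](subrK t) addrC lerD//; last by rewrite ler_piMr// ltW.
  by rewrite ler_piMr// subr_ge0.
have VI : 0 <= dotp (T (x + r *: h) - y) (r *: (k - h)).
  apply: first_order_condition => t t01.
  have := hmin _ (interp k t (ltW k1) t01).
  rewrite (_ : x + r *: (h + _) = x + r *: h + t *: (r *: (k - h)))//.
  by apply/rowP => i; rewrite !mxE; ring.
have hd : `|r *: h| < d.
  by rewrite normrZ gtr0_norm// (le_lt_trans _ rd)// ler_piMr// ltW.
have := dP _ hd; set q := _ - _ *m _ => qle.
have E : T (x + r *: h) - y = q - r *: ((k - h) *m H x).
  rewrite /q /y mulmxBl scalerBr -scalemxAl opprD addrA opprB.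
  by rewrite -!addrA; congr (_ + (_ + _)); rewrite addKr.
have {}qle : `|q| <= e * r.
  rewrite (le_trans qle)// normrZ (gtr0_norm r0) ler_pM2l//.
  by rewrite ler_piMr// ltW.
have kh : c * `|k - h| ^+ 2 <= n%:R * e * `|k - h|.
  rewrite (le_trans (cP _))//.
  move: VI; rewrite E dotpZr pmulr_rge0// dotpBl dotpZl subr_ge0 => VI.
  rewrite -(ler_pM2l r0) (le_trans VI)//.
  rewrite (le_trans (ler_norm _))// (le_trans (dotp_norm_le _ _))//.
  rewrite (@le_trans _ _ (n%:R * (e * r) * `|k - h|))//.
    by rewrite ler_wpM2r// ler_wpM2l.
  by rewrite le_eqVlt; apply/orP; left; apply/eqP; ring.
have h1 : `|h| < 1.
  have [kh0|kh0] := eqVneq (k - h) 0.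
    by move/eqP: kh0; rewrite subr_eq0 => /eqP <-.
  have kp : 0 < `|k - h| by rewrite normr_gt0.
  move: kh; rewrite expr2 mulrA ler_pM2r// => kh.
  have : c * `|k - h| < c * (1 - `|k|).
    rewrite (le_lt_trans kh)// /e mulrCA gtr_pMr ?mulr_gt0 ?subr_gt0//.
    by rewrite ltr_pdivrMr// mul1r ltrDl.
  rewrite ltr_pM2l// => khk.
  have := ler_distD k 0 h; rewrite !sub0r !normrN => /le_lt_trans; apply.
  by rewrite addrC -ltrBrDr.
exists h => // w; set z := x + r *: h.
(* Small enough for z + t (w - z) to stay in the cube of radius r around x. *)
pose t := (1 - `|h|) * r / (`|w - z| + 1 + r).
have D0 : 0 < `|w - z| + 1 + r by rewrite ltr_pwDr// addr_ge0.
have t0 : 0 < t by rewrite divr_gt0// mulr_gt0// subr_gt0.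
have t1 : t <= 1.
  rewrite ler_pdivrMr// mul1r (@le_trans _ _ r)//.
    by rewrite ler_piMl ?(ltW r0)// gerBl.
  by rewrite lerDr addr_ge0.
have := hmin (h + (t / r) *: (w - z)).
have -> : x + r *: (h + (t / r) *: (w - z)) = z + t *: (w - z).
  by rewrite scalerDr scalerA mulrCA mulfV ?gt_eqF// mulr1 addrA.
have tw : `|h + (t / r) *: (w - z)| <= 1.
  rewrite (le_trans (ler_normD _ _))// normrZ (gtr0_norm (divr_gt0 t0 r0)).
  rewrite addrC -lerBrDr.
  rewrite (_ : t / r * _ = (1 - `|h|) * (`|w - z| / (`|w - z| + 1 + r))).
    rewrite ler_piMr ?subr_ge0// ler_pdivrMr// mul1r -addrA lerDl.
    by rewrite addr_ge0// ltW.
  by rewrite /t; field; rewrite !gt_eqF.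
move=> /(_ tw); rewrite -/z dotpDr dotpZr dotpBr.
have := @convex_segment z (w - z) t; rewrite (ltW t0) t1 => /(_ isT).
rewrite [z + (w - z)]addrC subrK => A B.
rewrite -(ler_pM2l t0); move: A B.
rewrite -/y.
move: (psi (z + _)) (psi w) (psi z) (dotp y w) (dotp y z) => a b f g i.
by nra.
Qed.

End convex.

(** * Measurability and cubes *)

Section borel_rV.
Context (R : realType) (n : nat).

Lemma rV_rat_dense (x : 'rV[R]_n) e : 0 < e ->
  exists q : 'rV[rat]_n, `|x - map_mx ratr q| < e.
Proof.
move=> e0.
have [f fP] : {f : 'I_n -> rat & forall i, `|x ord0 i - ratr (f i)| < e}.
  apply: (@choice _ _ (fun i q => `|x ord0 i - ratr q| < e)) => i.
  have [|q] := @rat_in_itvoo _ (x ord0 i - e) (x ord0 i + e).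
    by rewrite ltrD2l gtrN.
  rewrite in_itv/= => /andP[h1 h2]; exists q.
  by rewrite ltr_distlC h1.
exists (\row_i f i); apply: rV_norm_lt => // i.
by have := fP i; rewrite !mxE.
Qed.

Lemma open_measurable_rV (U : set 'rV[R]_n) : open U -> measurable U.
Proof.
move=> oU.
pose box (q : 'rV[rat]_n) (r : rat) : set 'rV[R]_n :=
  [set v | forall i, (map_mx ratr q - const_mx (ratr r)) ord0 i <= v ord0 i <=
                     (map_mx ratr q + const_mx (ratr r) : 'rV[R]_n) ord0 i].
pose B (p : 'rV[rat]_n * rat) : set 'rV[R]_n :=
  if `[< box p.1 p.2 `<=` U >] then box p.1 p.2 else set0.
have -> : U = \bigcup_p B p.
  apply/seteqP; split => [x Ux|x [p _]]; last first.
    by rewrite /B; case: asboolP => // h; exact: h.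
  have /nbhs_ballP[e /= e0 eU] := open_nbhs_nbhs (conj oU Ux).
  have e2 : 0 < e / 2 by rewrite divr_gt0.
  have [r] := rat_in_itvoo e2.
  rewrite in_itv/= => /andP[r0 re].
  have [q qx] := rV_rat_dense x r0.
  have qxi i : `|x ord0 i - ratr (q ord0 i)| < ratr r.
    by rewrite (le_lt_trans _ qx)// (le_trans _ (coord_norm_le _ i))// !mxE.
  exists (q, r) => //; rewrite /B/= asboolT.
    by move=> i; rewrite !mxE; have := qxi i; rewrite ltr_distl => /andP[/ltW -> /ltW ->].
  move=> v vB; apply: eU; rewrite mx_norm_ball /ball_/=.
  apply: rV_norm_lt => // i; rewrite !mxE.
  rewrite (le_lt_trans (ler_distD (ratr (q ord0 i)) _ _))// [ltRHS]splitr ltrD//.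
    by rewrite (lt_trans (qxi i)).
  rewrite (le_lt_trans _ re)// distrC ler_distl.
  by have := vB i; rewrite !mxE.
apply: countable_bigcupT_measurable => [|p]; first exact: countableP.
by rewrite /B; case: asboolP => // _; exact: measurable_rV_box.
Qed.

Lemma continuous_measurable_rV (f : 'rV[R]_n -> R) : continuous f ->
  measurable_fun setT f.
Proof.
move=> /continuousP cf mD; apply: (measurability _ (RGenOpens.measurableE R)) => //.
move=> _ [_ [a [b ->] <-]]; rewrite setTI; apply: open_measurable_rV.
exact/cf/interval_open.
Qed.

Lemma measurable_dotp d (S : measurableType d) (f g : S -> 'rV[R]_n) :
  measurable_fun setT f -> measurable_fun setT g ->
  measurable_fun setT (fun s => dotp (f s) (g s)).
Proof.
move=> mf mg; apply: measurable_sum => i; apply: measurable_funM.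
  exact: (measurableT_comp (measurable_coord i) mf).
exact: (measurableT_comp (measurable_coord i) mg).
Qed.

Lemma measurable_fun_rVD d (S : measurableType d) (f g : S -> 'rV[R]_n) :
  measurable_fun setT f -> measurable_fun setT g ->
  measurable_fun setT (fun s => f s + g s).
Proof.
move=> mf mg; apply: measurable_fun_rV => i; under eq_fun do rewrite mxE.
apply: measurable_funD.
  exact: (measurableT_comp (measurable_coord i) mf).
exact: (measurableT_comp (measurable_coord i) mg).
Qed.

Lemma measurable_det m (f : 'rV[R]_n -> 'M[R]_m) :
  (forall i j, measurable_fun setT (fun x => f x i j)) ->
  measurable_fun setT (fun x => \det (f x)).
Proof.
move=> mf; apply: measurable_sum => s; apply: measurable_funM => //.
by apply: measurable_prod => i _.
Qed.

Lemma bernoulli (d : R) m : 0 <= d <= 1 -> 1 - m%:R * d <= (1 - d) ^+ m.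
Proof.
move=> /andP[d0 d1]; elim: m => [|m IH]; first by rewrite mul0r subr0 expr0.
rewrite exprS (le_trans _ (ler_wpM2l _ IH)) ?subr_ge0// -natr1.
rewrite -subr_ge0.
have -> : (1 - d) * (1 - m%:R * d) - (1 - (m%:R + 1) * d) = m%:R * d ^+ 2 by ring.
by rewrite mulr_ge0// sqr_ge0.
Qed.

Lemma leb_cube (c : 'rV[R]_n) r : 0 <= r ->
  leb R n [set v | `|v - c| <= r] = ((2 * r) ^+ n)%:E.
Proof.
move=> r0.
rewrite (_ : [set _ | _] = [set v : 'rV[R]_n | forall i,
   (c - const_mx r) ord0 i <= v ord0 i <= (c + const_mx r) ord0 i]).
  rewrite [LHS]lebesgue_rV_box => [|i]; last by rewrite !mxE lerD2l (le_trans _ r0)// oppr_le0.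
  congr _%:E; rewrite -[in RHS](card_ord n) -prodr_const; apply: eq_bigr => i _.
  by rewrite !mxE; ring.
apply/seteqP; split => v /= h.
  by move=> i; rewrite !mxE -ler_distl (le_trans _ h)// (le_trans _ (coord_norm_le _ i))// !mxE.
by apply: rV_norm_le => // i; have := h i; rewrite !mxE ler_distl.
Qed.

Lemma measurable_cube (c : 'rV[R]_n) r : measurable [set v : 'rV[R]_n | `|v - c| <= r].
Proof.
rewrite -[X in measurable X]setTI.
have -> : [set v : 'rV[R]_n | `|v - c| <= r] = (fun v => `|v - c|) @^-1` `]-oo, r].
  by apply/seteqP; split => v; rewrite /= in_itv.
apply: continuous_measurable_rV => //.
apply: (@lipschitz_continuous _ _ _ 1) => x y; rewrite mul1r.
by rewrite (le_trans (ler_dist_dist _ _))// opprB addrA subrK.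
Qed.

(** The closed cubes of radius 1 - d exhaust the open cube; their volume is
    controlled by Bernoulli's inequality. *)
Lemma leb_open_unit_cube_ge : ((2 ^+ n)%:E <= leb R n [set v : 'rV[R]_n | (`|v| < 1)%R])%E.
Proof.
apply/lee_subgt0Pr => e e0.
pose d : R := Num.min 1 (e / (2 ^+ n * (n%:R + 1))).
have N0 : 0 < n%:R + 1 :> R by rewrite ltr_wpDl.
have d0 : 0 < d by rewrite lt_min ltr01 divr_gt0// mulr_gt0// exprn_gt0.
have d1 : d <= 1 by rewrite ge_min lexx.
apply: (@le_trans _ _ (leb R n [set v : 'rV[R]_n | (`|v - 0| <= 1 - d)%R])); last first.
  apply: le_measure; rewrite ?inE//; first exact: measurable_cube.
    apply: open_measurable_rV.
    rewrite (_ : [set v | _] = ball (0 : 'rV[R]_n) 1); first exact: ball_open.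
    by apply/seteqP; split => v; rewrite mx_norm_ball /ball_/= sub0r normrN.
  by move=> v /=; rewrite subr0 => /le_lt_trans; apply; rewrite gtrBl.
rewrite leb_cube ?subr_ge0// -EFinB lee_fin exprMn.
have := @bernoulli d n; rewrite d1 ltW// => /(_ isT) h.
have P0 : 0 < 2 ^+ n :> R by rewrite exprn_gt0.
rewrite (le_trans _ (ler_wpM2l (ltW P0) h))//.
rewrite mulrBr mulr1 lerD2l lerN2.
rewrite (@le_trans _ _ (2 ^+ n * ((n%:R + 1) * (e / (2 ^+ n * (n%:R + 1))))))//.
  rewrite ler_pM2l//; apply: ler_pM; rewrite ?ler0n ?lerDl ?(ltW d0)//.
  by rewrite /d ge_min lexx orbT.
by rewrite le_eqVlt; apply/orP; left; apply/eqP; field; rewrite !gt_eqF.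
Qed.

Lemma limn_einf_ge (u : nat -> \bar R) l N :
  (forall m, (N <= m)%N -> (l <= u m)%E) -> (l <= limn_einf u)%E.
Proof.
move=> h; rewrite limn_einf_lim.
apply: (@le_trans _ _ (einfs u N)).
  by apply: le_ereal_inf_tmp => _ [m /= Nm <-]; exact: h.
rewrite (cvg_lim _ (@cvg_einfs_sup _ u))//.
by apply: ereal_sup_ubound; exists N.
Qed.

End borel_rV.

(** * Change of variables along the gradient *)

Lemma measurable_limn_einf d (S : measurableType d) (R : realType)
    (f : (S -> \bar R)^nat) : (forall m, measurable_fun setT (f m)) ->
  measurable_fun setT (fun x => limn_einf (f ^~ x)).
Proof.
move=> mf; rewrite /limn_einf; apply: measurableT_comp => //.
apply: measurable_fun_limn_esup => m.
by apply: measurableT_comp => //; exact: mf.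
Qed.

Section measurable_derivatives.
Context (R : realType) (n : nat) (psi : 'rV[R]_n -> R).
Hypothesis psi2 : C2 psi.

Lemma measurable_grad : measurable_fun setT (grad psi).
Proof.
apply: measurable_fun_rV => i; under eq_fun do rewrite mxE.
by apply: continuous_measurable_rV => x; have [_] := psi2.1 x i.
Qed.

Lemma measurable_det_hessian : measurable_fun setT (fun x => \det (hessian psi x)).
Proof.
apply: measurable_det => i j; under eq_fun do rewrite mxE.
by apply: continuous_measurable_rV => x; have [_] := psi2.2 j x i.
Qed.

End measurable_derivatives.

Section change_of_variables.
Context (R : realType) (n : nat) (phi : 'rV[R]_n -> R).
Hypothesis phi0 : forall x, 0 < phi x.
Let psi x := - ln (phi x).
Hypotheses (psi2 : C2 psi) (psi_sc : strictly_convex psi).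

Let T := grad psi.
Let H := hessian psi.
Let K y z := expR (psi z - dotp y z).
Let g := dual phi.

Lemma dual_kernelE y z : expR (- dotp y z) / phi z = expR (- ln (phi z) - dotp y z).
Proof.
by rewrite [RHS]expRD mulrC [expR (- ln _)]expRN lnK ?posrE.
Qed.

Let lb y : has_lbound [set expR (- dotp y z) / phi z | z in [set: 'rV[R]_n]].
Proof. by exists 0 => _ [z _ <-]; rewrite divr_ge0// ?expR_ge0// ltW. Qed.

Lemma dual_ge0 y : 0 <= dual phi y.
Proof.
apply: lb_le_inf; first by exists (expR (- dotp y 0) / phi 0); exists 0.
by move=> _ [z _ <-]; rewrite divr_ge0// ?expR_ge0// ltW.
Qed.

Lemma dual_le y z : dual phi y <= expR (- ln (phi z) - dotp y z).
Proof. by rewrite -dual_kernelE; apply: ge_inf; [exact: lb|exists z]. Qed.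

Lemma dual_eq y z : (forall w, psi z - dotp y z <= psi w - dotp y w) ->
  dual phi y = expR (psi z - dotp y z).
Proof.
move=> zm; apply/eqP; rewrite eq_le dual_le/=.
apply: lb_le_inf; first by exists (expR (- dotp y 0) / phi 0); exists 0.
by move=> _ [w _ <-]; rewrite dual_kernelE ler_expR zm.
Qed.

(** The infimum defining the dual function at T x is attained at x, by the
    gradient inequality. *)
Lemma dual_grad x : dual phi (T x) = expR (psi x - dotp (T x) x).
Proof.
apply: dual_eq => w; have := grad_ineq psi2 psi_sc x w.
rewrite dotpBr -/T.
by move: (psi x) (psi w) (dotp _ x) (dotp _ w) => a b c d h; lra.
Qed.

(** The pairs (x, y) for which psi - <y, .> comes arbitrarily close to its infimum
    in the cube of radius r around x; by compactness this says that the infimum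
    is attained there. Quantifying over rational points of the cube makes
    measurability immediate. *)
Definition min_near r : set ('rV[R]_n * 'rV[R]_n) :=
  [set p | forall j : nat, exists2 q : 'rV[rat]_n, `|map_mx ratr q : 'rV[R]_n| <= 1 &
     K p.2 (p.1 + r *: map_mx ratr q) < g p.2 + j.+1%:R^-1].

Hypothesis mg : measurable_fun setT g.

Lemma continuous_kernel y x r : continuous (fun h : 'rV[R]_n => K y (x + r *: h)).
Proof.
move=> h; apply: (@continuous_comp _ _ _
    (fun h : 'rV[R]_n => psi (x + r *: h) - dotp y (x + r *: h)) expR).
  exact: continuous_tilted.
exact: continuous_expR.
Qed.

Lemma measurable_min_near r : measurable (min_near r).
Proof.
pose A j q : set ('rV[R]_n * 'rV[R]_n) := [set p |
  K p.2 (p.1 + r *: map_mx ratr q) < g p.2 + j.+1%:R^-1].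
pose B j (q : 'rV[rat]_n) := if `|map_mx ratr q : 'rV[R]_n| <= 1 then A j q else set0.
have -> : min_near r = \bigcap_j \bigcup_q B j q.
  apply/seteqP; split => p h.
    by move=> j _; have [q q1 qK] := h j; exists q => //; rewrite /B q1.
  by move=> j; have [q _] := h j I; rewrite /B; case: ifPn => // q1 ?; exists q.
apply: bigcap_measurable => // j _; apply: countable_bigcupT_measurable => [|q].
  exact: countableP.
rewrite /B; case: ifPn => // _.
have mA : measurable_fun setT (fun p : 'rV[R]_n * 'rV[R]_n =>
    K p.2 (p.1 + r *: map_mx ratr q) < g p.2 + j.+1%:R^-1).
  have mz : measurable_fun setT (fun p : 'rV[R]_n * 'rV[R]_n =>
      p.1 + r *: map_mx ratr q) by apply: measurable_fun_rVD.
  apply: measurable_fun_ltr; last first.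
    by apply: measurable_funD => //; exact: (measurableT_comp mg measurable_snd).
  apply: measurableT_comp => //; apply: measurable_funB.
    exact: (measurableT_comp (continuous_measurable_rV (C1_continuous psi2.1)) mz).
  exact: measurable_dotp.
by have := mA measurableT [set true] I; rewrite setTI.
Qed.

(** z is the minimiser of psi - <y, .>, which is attained by compactness and is the
    same for all w by strict convexity. *)
Lemma min_near_section r x y : 0 < r -> min_near r (x, y) ->
  exists z, forall w, min_near r (w, y) -> `|w - z| <= r.
Proof.
move=> r0 gx.
have minz w : min_near r (w, y) -> exists2 z, `|w - z| <= r &
    forall v, psi z - dotp y z <= psi v - dotp y v.
  move=> gw.
  have B0 : [set v : 'rV[R]_n | `|v| <= 1] !=set0 by exists 0; rewrite /= normr0.
  have [h /set_mem/= hB hmin] := EVT_min_rV B0 (@compact_unit_ball R n)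
    (continuous_subspaceT (@continuous_tilted _ _ _ psi2 y w r)).
  exists (w + r *: h).
    by rewrite opprD addNKr normrN normrZ gtr0_norm// ler_piMr// ltW.
  move=> v; rewrite -ler_expR; apply: (@le_trans _ _ (g y)); last first.
    exact: dual_le.
  apply/ler_addgt0Pr => e e0.
  have [j je] : exists j : nat, j.+1%:R^-1 < e.
    exists (Num.trunc e^-1); rewrite invf_plt ?posrE//.
    exact: truncnS_gt.
  have [q q1 /ltW qK] := gw j.
  rewrite (@le_trans _ _ (g y + j.+1%:R^-1))// ?lerD2l ?(ltW je)//.
  by rewrite (le_trans _ qK)// ler_expR hmin// inE.
have [z zx zm] := minz _ gx; exists z => w gw.
have [z' zw zm'] := minz _ gw.
by rewrite (strict_min_unique psi_sc zm zm').
Qed.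

Lemma leb_min_near_section r y : 0 < r ->
  (leb R n (ysection (min_near r) y) <= ((2 * r) ^+ n)%:E)%E.
Proof.
move=> r0; have [->|/set0P[x]] := eqVneq (ysection (min_near r) y) set0.
  by rewrite measure0 lee_fin exprn_ge0// mulr_ge0// ltW.
rewrite /ysection/= inE => gx.
have [z zP] := min_near_section r0 gx.
rewrite -(leb_cube z (ltW r0)); apply: le_measure; rewrite ?inE.
- exact: measurable_ysection (measurable_min_near r).
- exact: measurable_cube.
- by move=> w; rewrite /ysection/= inE => /zP.
Qed.

(** The minimiser given by [local_surj] provides membership. The lower bound
    follows from the gradient inequality at x, which yields
    dual phi y >= dual phi (T x) * exp (- r C) for a constant C. *)
Lemma min_near_eventually x (k : 'rV[R]_n) e : \det (H x) != 0 -> `|k| < 1 -> 0 < e ->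
  exists2 d, 0 < d & forall r, 0 < r < d ->
    let y := T x + k *m (r *: H x) in min_near r (x, y) /\ g (T x) - e <= g y.
Proof.
move=> dH k1 e0; have [d d0 dP] := local_surj psi2 psi_sc dH k1.
pose kH := k *m H x.
pose C := n%:R * `|kH| * (`|x| + 1).
have C0 : 0 <= C by rewrite !mulr_ge0// addr_ge0.
pose G := g (T x).
have G0 : 0 <= G by exact: dual_ge0.
have D0 : 0 < G * C + 1 by rewrite ltr_wpDl// mulr_ge0.
exists (Num.min d (Num.min 1 (e / (G * C + 1)))).
  by rewrite !lt_min d0 ltr01 divr_gt0.
move=> r /andP[r0]; rewrite !lt_min => /andP[rd /andP[r1 re]] y.
have yE : y = T x + r *: kH by rewrite /y -scalemxAr.
have [|h h1] := dP r; first by rewrite r0.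
rewrite /= -/H -/T -/kH -yE => hmin.
have gy : g y = K y (x + r *: h) by exact: dual_eq.
split.
  move=> j /=; rewrite gy.
  have j0 : 0 < j.+1%:R^-1 :> R by rewrite invr_gt0.
  have /(@cvgrPdist_lt _ _ _ (nbhs h) (nbhs_filter h))/(_ _ j0)/nbhs_ballP[a a0 aP] :=
    @continuous_kernel y x r h.
  have b0 : 0 < Num.min a (1 - `|h|) by rewrite lt_min a0 subr_gt0.
  have [q] := rV_rat_dense h b0; rewrite lt_min => /andP[qa qh].
  exists q.
    rewrite -[X in `|X|](subrK h) (le_trans (ler_normD _ _))//.
    by rewrite distrC -lerBrDr ltW.
  have := aP (map_mx ratr q); rewrite mx_norm_ball /ball_/= => /(_ qa).
  by rewrite distrC ltr_distl => /andP[_].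
have GE : G = expR (psi x - dotp (T x) x) by exact: dual_grad.
rewrite gy -/G /K.
have tangent := grad_ineq psi2 psi_sc x (x + r *: h).
rewrite (_ : x + r *: h - x = r *: h) in tangent; last by rewrite addrAC subrr add0r.
rewrite dotpZr -/T in tangent.
have bound : psi x - dotp (T x) x - r * C <= psi (x + r *: h) - dotp y (x + r *: h).
  have E : dotp y (x + r *: h) = dotp (T x) x + r * dotp (T x) h + r * dotp kH (x + r *: h).
    by rewrite yE dotpDl dotpDr !dotpZr dotpZl.
  have : dotp kH (x + r *: h) <= C.
    rewrite (le_trans (ler_norm _))// (le_trans (dotp_norm_le _ _))//.
    rewrite ler_wpM2l ?mulr_ge0// (le_trans (ler_normD _ _))// lerD2l.
    by rewrite normrZ gtr0_norm// mulr_ile1 ?normr_ge0 ?(ltW r0) ?(ltW r1) ?(ltW h1).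
  rewrite -(ler_pM2l r0) E; move: tangent.
  by move: (psi x) (psi _) (dotp (T x) x) (r * dotp (T x) h) (r * dotp kH _) (r * C)
    => a b c f u v; lra.
rewrite -ler_expR in bound.
rewrite expRD -GE in bound; apply: le_trans bound.
have := expR_ge1Dx (- (r * C)) => /(ler_wpM2l G0); apply: le_trans.
rewrite mulrDr mulr1 lerD2l mulrN lerN2.
have : r * (G * C + 1) < e by rewrite -ltr_pdivlMr.
rewrite mulrDr mulr1 mulrCA => /ltW; apply: le_trans.
by rewrite lerDl ltW.
Qed.

Local Open Scope ereal_scope.

(** The indicator of these pairs, weighted by dual phi y. Its double integral is
    bounded above by integrating in x first ([double_integral_le]), and below by
    integrating in y first (the functions [w]). *)
Let W r (p : 'rV[R]_n * 'rV[R]_n) : \bar R := (g p.2 * \1_(min_near r) p)%:E.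

Let W0 r p : 0 <= W r p.
Proof. by rewrite lee_fin mulr_ge0// dual_ge0. Qed.

Let mW r : measurable_fun setT (W r).
Proof.
apply/measurable_EFinP; apply: measurable_funM.
  exact: (measurableT_comp mg measurable_snd).
by apply: measurable_indic; exact: measurable_min_near.
Qed.

Let g0 x : 0 <= (g x)%:E.
Proof. by rewrite lee_fin dual_ge0. Qed.

Let gE : measurable_fun setT (fun y => (g y)%:E).
Proof. exact/measurable_EFinP. Qed.

Lemma double_integral_le r : (0 < r)%R ->
  \int[leb R n]_x \int[leb R n]_y W r (x, y) <=
  ((2 * r) ^+ n)%:E * \int[leb R n]_y (g y)%:E.
Proof.
move=> r0; rewrite (@fubini_tonelli _ _ _ _ _ (leb R n) (leb R n) (W r) (mW r) (W0 r)).
rewrite -ge0_integralZl//; last by rewrite lee_fin exprn_ge0// mulr_ge0// ltW.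
apply: ge0_le_integral => //.
- by move=> y _; exact: integral_ge0.
- exact: (@measurable_fun_fubini_tonelli_G _ _ _ _ _ (leb R n) (W r) (mW r) (W0 r)).
- by apply: measurable_funeM.
move=> y _; rewrite (eq_integral (fun x => (g y)%:E *
    (\1_(ysection (min_near r) y) x)%:E)); last first.
  by move=> x _; rewrite /W -EFinM !indicE mem_ysection.
have ms := measurable_ysection y (measurable_min_near r).
rewrite ge0_integralZl//; last first.
  by apply/measurable_EFinP; exact: measurable_indic.
rewrite muleC lee_wpmul2r// integral_indic// setIT.
exact: leb_min_near_section.
Qed.

Let N : set 'rV[R]_n := [set x | \det (H x) != 0%R].

Let mN : measurable N.
Proof.
rewrite -[X in measurable X]setTI (_ : N = (fun x => \det (H x)) @^-1` (~` [set 0%R])).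
  by apply: (measurable_det_hessian psi2) => //; exact: measurableC.
by apply/seteqP; split => x /= /eqP.
Qed.

Lemma measurable_dual_grad : measurable_fun setT (fun x => g (T x)).
Proof. exact: (measurableT_comp mg (measurable_grad psi2)). Qed.

Lemma det_hessian_gt0 x : N x -> (0 < \det (H x))%R.
Proof. by move=> Nx; have [] := integral_linear (hessian_posdef psi2 psi_sc Nx). Qed.

Let r_ m : R := m.+1%:R^-1.
Let r_0 m : (0 < r_ m)%R. Proof. by rewrite invr_gt0. Qed.

Let w m x := ((r_ m) ^- n)%:E * \int[leb R n]_y W (r_ m) (x, y).

Let r_n m : (0 <= (r_ m) ^- n)%R.
Proof. by rewrite invr_ge0 exprn_ge0// ltW. Qed.

Let mw m : measurable_fun setT (w m).
Proof.
apply: measurable_funeM.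
exact: (@measurable_fun_fubini_tonelli_F _ _ _ _ _ (leb R n) (W (r_ m)) (mW _) (W0 _)).
Qed.

Let w0 m x : 0 <= w m x.
Proof. by rewrite mule_ge0 ?lee_fin// integral_ge0. Qed.

Let integral_w_le m : \int[leb R n]_x w m x <= (2 ^+ n)%:E * \int[leb R n]_y (g y)%:E.
Proof.
rewrite ge0_integralZl//; last 3 first.
- exact: (@measurable_fun_fubini_tonelli_F _ _ _ _ _ (leb R n) (W (r_ m)) (mW _) (W0 _)).
- by move=> x _; rewrite integral_ge0.
- by rewrite lee_fin.
rewrite (le_trans (lee_wpmul2l _ (double_integral_le (r_0 m)))) ?lee_fin//.
by rewrite muleA -EFinM exprMn mulrCA mulVf ?mulr1// expf_neq0// gt_eqF//.
Qed.

(** After the substitution y = T x + r (k H) the factor r^-n cancels the power of r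
    in the determinant, and Fatou's lemma in k leaves the volume 2^n of the open
    unit cube. *)
Let w_ge x : N x -> (2 ^+ n * (g (T x) * \det (H x)))%:E <= limn_einf (w ^~ x).
Proof.
move=> Nx; have D0 := det_hessian_gt0 Nx.
have Hr m (v : 'rV[R]_n) : v != 0%R -> (0 < dotp (v *m (r_ m *: H x)) v)%R.
  by move=> v0; rewrite -scalemxAr dotpZl mulr_gt0// hessian_posdef.
pose f m k := (\det (H x))%:E * W (r_ m) (x, (T x + k *m (r_ m *: H x)))%R.
have mf m : measurable_fun setT (f m).
  apply: measurable_funeM; apply: (measurableT_comp (mW (r_ m))).
  by apply: measurable_fun_pair => //; exact: measurable_affine.
have f0 m k : 0 <= f m k by rewrite mule_ge0// lee_fin ltW.
have wE m : w m x = \int[leb R n]_k f m k.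
  have [_ L] := integral_linear (Hr m).
  have mWx : measurable_fun setT (fun y => W (r_ m) (x, y)).
    exact: (measurable_fun_pair2 x (mW (r_ m))).
  rewrite /w (L (T x) (fun y => W (r_ m) (x, y)))// detZ.
  rewrite muleA -EFinM mulrA mulVf ?mul1r ?expf_neq0 ?gt_eqF//.
  rewrite /f ge0_integralZl//; last by rewrite lee_fin ltW.
  exact: (measurableT_comp mWx (measurable_affine _ _)).
have -> : w ^~ x = fun m => \int[leb R n]_k f m k by apply/funext => m; exact: wE.
apply: le_trans (fatou _ measurableT mf (fun m k _ => f0 m k)).
pose U : set 'rV[R]_n := [set k | (`|k| < 1)%R].
have mU : measurable U.
  apply: open_measurable_rV.
  rewrite (_ : U = ball (0%R : 'rV[R]_n) 1%R); first exact: ball_open.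
  by apply/seteqP; split => v; rewrite mx_norm_ball /ball_/= sub0r normrN.
apply: (@le_trans _ _ (\int[leb R n]_k ((g (T x) * \det (H x))%:E * (\1_U k)%:E))).
  have GD : (0 <= g (T x) * \det (H x))%R by rewrite mulr_ge0 ?dual_ge0// ltW.
  rewrite ge0_integralZl//; last first.
    by apply/measurable_EFinP; exact: measurable_indic.
  rewrite integral_indic// setIT mulrC EFinM lee_wpmul2l//.
  exact: leb_open_unit_cube_ge.
apply: ge0_le_integral => //.
- by move=> k _; rewrite -EFinM lee_fin !mulr_ge0 ?dual_ge0// ltW.
- by apply: measurable_funeM; apply/measurable_EFinP; exact: measurable_indic.
- exact: measurable_limn_einf.
move=> k _; rewrite indicE; case: (boolP (k \in U)) => kU; last first.
  by rewrite mule0 (limn_einf_ge (N := 0%N)).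
rewrite inE in kU; rewrite mule1; apply/lee_subgt0Pr => e e0.
have e'0 : (0 < e / \det (H x))%R by rewrite divr_gt0.
have [d d0 dP] := min_near_eventually Nx kU e'0.
have [M Md] : exists M : nat, (M.+1%:R^-1 < d)%R.
  exists (Num.trunc d^-1)%R; rewrite invf_plt ?posrE//.
  exact: truncnS_gt.
apply: (@limn_einf_ge _ _ _ M) => m Mm.
have [|gd gl] := dP (r_ m).
  rewrite r_0 (le_lt_trans _ Md)// lef_pV2 ?posrE//.
  by rewrite ler_nat ltnS.
rewrite /f /W /= indicE mem_set// mulr1 -EFinM -EFinB lee_fin.
have := ler_wpM2l (ltW D0) gl.
by rewrite mulrBr [(_ * (e / _))%R]mulrC divfK ?gt_eqF// [(_ * g (T x))%R]mulrC.
Qed.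

(** Fatou's lemma along r = 1 / (m + 1). Only one inequality of the change of
    variables formula holds in general, since T need not be onto. *)
Lemma integral_dual_grad_le :
  \int[leb R n]_(x in [set x | \det (H x) != 0%R]) (g (T x) * \det (H x))%:E <=
  \int[leb R n]_y (g y)%:E.
Proof.
have P0 : (0 < 2 ^+ n :> R)%R by rewrite exprn_gt0.
rewrite -/N -(@lee_pmul2l _ (2 ^+ n)%:E)//.
have mF : measurable_fun N (fun x => (g (T x) * \det (H x))%:E).
  apply: measurable_funTS; apply/measurable_EFinP; apply: measurable_funM.
    exact: measurable_dual_grad.
  exact: (measurable_det_hessian psi2).
have F0 x : N x -> 0 <= (g (T x) * \det (H x))%:E.
  by move=> Nx; rewrite lee_fin mulr_ge0 ?dual_ge0// ltW// det_hessian_gt0.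
rewrite -ge0_integralZl//.
apply: (@le_trans _ _ (\int[leb R n]_(x in N) limn_einf (w ^~ x))).
  apply: ge0_le_integral => //.
  - by move=> x Nx; apply: mule_ge0; [rewrite lee_fin ltW|exact: F0].
  - exact: measurable_funeM.
  - apply: measurable_funTS; exact: measurable_limn_einf.
apply: (le_trans (fatou _ mN (fun m => measurable_funTS (mw m)) (fun m x _ => w0 m x))).
rewrite limn_einf_lim.
apply: lime_le; first exact: is_cvg_einfs.
apply: nearW => m.
apply: (@le_trans _ _ (\int[leb R n]_(x in N) w m x)).
  by apply: ereal_inf_lbound; exists m => /=.
rewrite (le_trans _ (integral_w_le m))//.
by apply: ge0_subset_integral.
Qed.

End change_of_variables.

(** * Integrability of log-concave functions *)

Section scaling.
Context (R : realType) (n : nat).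

Lemma integral_scale s (b : 'rV[R]_n) (f : 'rV[R]_n -> \bar R) : 0 < s ->
  measurable_fun setT f -> (forall x, 0 <= f x)%E ->
  (\int[leb R n]_x f x = (s ^+ n)%:E * \int[leb R n]_x f (b + s *: x)%R)%E.
Proof.
move=> s0 mf f0.
have s_pos (v : 'rV[R]_n) : v != 0 -> 0 < dotp (v *m s%:M) v.
  move=> v0; rewrite mul_mx_scalar dotpZl mulr_gt0//.
  by rewrite (lt_le_trans _ (dotp_sqr_ge v))// exprn_gt0// normr_gt0.
have [_ /(_ b f mf f0) ->] := integral_linear s_pos.
rewrite det_scalar; congr (_ * _)%E; apply: eq_integral => x _.
by rewrite mul_mx_scalar.
Qed.

Lemma measurable_rV_scale s (b : 'rV[R]_n) :
  measurable_fun setT (fun x : 'rV[R]_n => b + s *: x).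
Proof.
apply: measurable_fun_rV => i; under eq_fun do rewrite !mxE.
by apply: measurable_funD => //; apply: measurable_funM => //; exact: measurable_coord.
Qed.

(** The integral is at least the minimum of f over the unit cube times the volume
    of the cube. *)
Lemma integral_continuous_gt0 (f : 'rV[R]_n -> R) : continuous f ->
  (forall x, 0 < f x) -> (0 < \int[leb R n]_x (f x)%:E)%E.
Proof.
move=> cf f0.
have B0 : [set v : 'rV[R]_n | `|v| <= 1] !=set0 by exists 0; rewrite /= normr0.
have [h _ hmin] := EVT_min_rV B0 (@compact_unit_ball R n) (continuous_subspaceT cf).
pose Q := [set v : 'rV[R]_n | `|v - 0| <= 1].
have mQ : measurable Q by exact: measurable_cube.
apply: (@lt_le_trans _ _ (\int[leb R n]_x ((f h)%:E * (\1_Q x)%:E))%E).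
  rewrite ge0_integralZl//; last 2 first.
  - by apply/measurable_EFinP; exact: measurable_indic.
  - by rewrite lee_fin ltW.
  rewrite integral_indic// setIT [X in (_ * X)%E](leb_cube 0 ler01) -EFinM lte_fin mulr1.
  by rewrite mulr_gt0// exprn_gt0.
apply: ge0_le_integral => //.
- by move=> x _; rewrite -EFinM lee_fin mulr_ge0// ltW.
- by apply: measurable_funeM; apply/measurable_EFinP; exact: measurable_indic.
- by apply/measurable_EFinP; exact: continuous_measurable_rV.
move=> x _; rewrite -EFinM lee_fin indicE; case: (boolP (x \in Q)).
  by rewrite inE /Q/= subr0 mulr1 => xQ; apply: hmin; rewrite inE.
by rewrite mulr0 ltW.
Qed.

End scaling.

Lemma ln_le_subr1 (R : realType) (x : R) : 0 < x -> ln x <= x - 1.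
Proof.
by move=> x0; have := expR_ge1Dx (ln x); rewrite lnK ?posrE// => h; rewrite lerBrDl.
Qed.

Section log_concave_integrability.
Context (R : realType) (n : nat) (psi : 'rV[R]_n -> R).
Hypotheses (psi2 : C2 psi) (psi_sc : strictly_convex psi).
Let phi x := expR (- psi x).
Hypothesis phi_int : (leb R n).-integrable [set: 'rV[R]_n] (EFin \o phi).

Let T := grad psi.

Let psi_cont : continuous psi. Proof. exact: C1_continuous psi2.1. Qed.

Let exp_cont (f : 'rV[R]_n -> R) : continuous f -> continuous (fun x => expR (f x)).
Proof. by move=> cf x; apply: (continuous_comp (cf x)); exact: continuous_expR. Qed.

Let phi_cont : continuous phi.
Proof. by apply: exp_cont => x; apply: continuousN; exact: psi_cont. Qed.

Let mphi : measurable_fun setT (EFin \o phi).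
Proof. by apply/measurable_EFinP; exact: continuous_measurable_rV. Qed.

Let phi_ge0 x : (0 <= (phi x)%:E)%E.
Proof. by rewrite lee_fin expR_ge0. Qed.

Let root x := expR (- psi x / 2).

Let root_cont : continuous root.
Proof.
apply: exp_cont => x.
apply: (@continuousM _ _ (fun x => - psi x) (fun=> 2^-1)); last exact: cst_continuous.
by apply: continuousN; exact: psi_cont.
Qed.

Let mroot : measurable_fun setT (EFin \o root).
Proof. by apply/measurable_EFinP; exact: continuous_measurable_rV. Qed.

Lemma root_midpoint x y : root x * root y <= phi (2^-1 *: y + 2^-1 *: x).
Proof.
rewrite -expRD ler_expR.
have h : 0 <= (2^-1 : R) <= 1 by rewrite invr_ge0 ler0n/= invf_le1// ler1n.
have := convex_segment psi_sc y (x - y) h.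
rewrite [y + (x - y)]addrC subrK.
rewrite (_ : y + 2^-1 *: (x - y) = 2^-1 *: y + 2^-1 *: x); last first.
  by apply/rowP => i; rewrite !mxE; field.
by move: (psi x) (psi y) (psi _) => a b c; lra.
Qed.

Let integral_half y : (\int[leb R n]_x (phi (2^-1 *: y + 2^-1 *: x))%:E =
  (2 ^+ n)%:E * \int[leb R n]_x (phi x)%:E)%E.
Proof.
have h : 0 < 2^-1 :> R by rewrite invr_gt0.
rewrite (integral_scale (2^-1 *: y) h (f := fun x => (phi x)%:E))//.
by rewrite muleA -EFinM -exprMn mulfV// expr1n mul1e.
Qed.

(** [root_midpoint] integrated in x. At y = 0 it shows that [root] is integrable,
    and for general y that [root] is bounded. *)
Let integral_root_le y : ((root y)%:E * \int[leb R n]_x (root x)%:E <=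
  (2 ^+ n)%:E * \int[leb R n]_x (phi x)%:E)%E.
Proof.
have root_ge0 x : (0 <= (root x)%:E)%E by rewrite lee_fin expR_ge0.
rewrite -(integral_half y) -ge0_integralZl//.
apply: ge0_le_integral => //.
- by move=> x _; rewrite -EFinM lee_fin mulr_ge0 ?expR_ge0.
- exact: measurable_funeM.
- apply/measurable_EFinP; apply: measurableT_comp.
    exact: continuous_measurable_rV.
  exact: measurable_rV_scale.
by move=> x _; rewrite -EFinM lee_fin mulrC root_midpoint.
Qed.

Let phi_lty : (\int[leb R n]_x (phi x)%:E < +oo)%E.
Proof. exact: integrable_lty phi_int. Qed.

Let integral_root_gt0 : (0 < \int[leb R n]_x (root x)%:E)%E.
Proof. by apply: integral_continuous_gt0 => // x; exact: expR_gt0. Qed.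

Let integral_root_lty : (\int[leb R n]_x (root x)%:E < +oo)%E.
Proof.
have r0 : 0 < root 0 by exact: expR_gt0.
have := integral_root_le 0; case: (\int[leb R n]_x (root x)%:E)%E => [r||]//.
  by rewrite ltry.
rewrite gt0_muley ?lte_fin// leye_eq => /eqP E.
have : ((2 ^+ n)%:E * \int[leb R n]_x (phi x)%:E < +oo)%E.
  by rewrite lte_mul_pinfty// lee_fin exprn_ge0.
by rewrite E ltxx.
Qed.

Lemma root_integrable : (leb R n).-integrable [set: 'rV[R]_n] (EFin \o root).
Proof.
apply/integrableP; split => //.
under eq_integral do rewrite gee0_abs ?lee_fin ?expR_ge0//.
exact: integral_root_lty.
Qed.

Lemma root_bounded : exists2 M, 0 < M & forall x, root x <= M.
Proof.
have fp : (\int[leb R n]_x (phi x)%:E)%E \is a fin_num.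
  by rewrite ge0_fin_numE// integral_ge0.
have fr : (\int[leb R n]_x (root x)%:E)%E \is a fin_num.
  by rewrite ge0_fin_numE// ltW.
pose I := fine (\int[leb R n]_x (phi x)%:E)%E.
pose J := fine (\int[leb R n]_x (root x)%:E)%E.
have J0 : 0 < J by rewrite fine_gt0// integral_root_gt0.
exists (2 ^+ n * I / J + 1).
  by rewrite ltr_wpDl// divr_ge0 ?(ltW J0)// mulr_ge0 ?exprn_ge0// fine_ge0// integral_ge0.
move=> x; have := integral_root_le x.
rewrite -(fineK fp) -(fineK fr) -/I -/J -!EFinM lee_fin -ler_pdivlMr// => /le_trans; apply.
by rewrite lerDl.
Qed.

(** With u = root x one has phi psi = - 2 u^2 ln u, and u |ln u| is bounded for u
    in ]0, M] as - ln u <= 1/u - 1 and ln u <= u - 1. *)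
Lemma phi_psi_integrable :
  (leb R n).-integrable [set: 'rV[R]_n] (fun x => (phi x * psi x)%:E).
Proof.
have [M M0 rM] := root_bounded.
apply: (@le_integrable _ _ _ _ _ _ _ (fun x => (2 * (1 + M ^+ 2))%:E * (root x)%:E)%E).
- by [].
- apply/measurable_EFinP; apply: measurable_funM; exact: continuous_measurable_rV.
- move=> x _; rewrite -EFinM !abse_EFin lee_fin.
  have r0 : 0 < root x by exact: expR_gt0.
  have -> : phi x = root x * root x.
    by rewrite -expRD; congr expR; field.
  have -> : psi x = - 2 * ln (root x) by rewrite expRK; field.
  rewrite [leRHS]ger0_norm; last by rewrite mulr_ge0 ?(ltW r0)// mulr_ge0// addr_ge0// sqr_ge0.
  have -> : root x * root x * (- 2 * ln (root x)) = - (2 * (root x * (root x * ln (root x)))).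
    by ring.
  rewrite normrN normrM ger0_norm// -!mulrA ler_pM2l// normrM (gtr0_norm r0) mulrC.
  rewrite ler_pM2r//.
  have A : ln (root x) <= root x - 1 by exact: ln_le_subr1.
  have B : - ln (root x) <= (root x)^-1 - 1.
    by rewrite -lnV ?posrE// ln_le_subr1// invr_gt0.
  have C : root x * (root x)^-1 = 1 by rewrite mulfV// gt_eqF.
  have D := rM x.
  have E : root x * - ln (root x) <= 1 - root x.
    by have := ler_wpM2l (ltW r0) B; rewrite mulrBr C mulr1.
  have F : root x * ln (root x) <= root x * (root x - 1).
    by rewrite ler_pM2l.
  have G : root x * root x <= M ^+ 2 by rewrite expr2 ler_pM// ltW.
  have c0 : 0 <= M ^+ 2 by exact: sqr_ge0.
  move: r0 c0 E F G; clear A B C D; rewrite ler_norml mulrN mulrBr mulr1 lerNl.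
  move: (root x * ln (root x)) => a; move: (root x * root x) => b.
  move: (M ^+ 2) (root x) => c d d0 c0 E F G.
  by apply/andP; split; lra.
- by apply: integrableZl => //; exact: root_integrable.
Qed.

Let F x := dotp (T x) x.
(** The integrable minorant of phi F and of the difference quotients [quot]. *)
Let ell x := phi x * (psi x - psi 0).

Lemma ell_integrable : (leb R n).-integrable [set: 'rV[R]_n] (EFin \o ell).
Proof.
apply: (@eq_integrable _ _ _ _ _ _
    (fun x => (phi x * psi x)%:E - (psi 0)%:E * (phi x)%:E)%E) => //.
  by move=> x _ /=; congr _%:E; rewrite /ell; ring.
by apply: integrableB => //; [exact: phi_psi_integrable|exact: integrableZl].
Qed.

Lemma ell_le x : ell x <= phi x * F x.
Proof.
rewrite ler_wpM2l ?expR_ge0//.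
have := grad_ineq psi2 psi_sc x 0; rewrite sub0r dotpNr -/T -/(F x).
by move: (psi x) (psi 0) (F x) => a b c; lra.
Qed.

(** With the contraction factor 1 - d < 1: its limit as d tends to 0 is phi F, and
    its integral is a multiple of that of phi. *)
Let quot d (x : 'rV[R]_n) := (phi (0 + (1 - d) *: x) - phi x) / d.

Let shrinkE d (x : 'rV[R]_n) : 0 + (1 - d) *: x = x + d *: (- x).
Proof. by rewrite add0r scalerBl scale1r scalerN. Qed.

Let phi_diff x y : phi x * (psi x - psi y) <= phi y - phi x.
Proof.
have -> : phi y = phi x * expR (psi x - psi y).
  by rewrite -expRD; congr expR; ring.
rewrite -{3}[phi x]mulr1 -mulrBr ler_wpM2l ?expR_ge0//.
by rewrite lerBrDl expR_ge1Dx.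
Qed.

Lemma ell_le_quot d x : 0 < d <= 1 -> ell x <= quot d x.
Proof.
move=> /andP[d0 d1]; rewrite ler_pdivlMr// (le_trans _ (phi_diff _ _))//.
rewrite /ell -mulrA ler_wpM2l ?expR_ge0// shrinkE.
have := @convex_segment _ _ _ psi_sc x (- x) d; rewrite (ltW d0) d1 => /(_ isT).
rewrite subrr; move: (psi x) (psi 0) (psi _) => a b c; lra.
Qed.

Let measurable_phiF : measurable_fun setT (fun x => phi x * F x).
Proof.
apply: measurable_funM; first exact: continuous_measurable_rV.
exact: (measurable_dotp (measurable_grad psi2)).
Qed.

Let del m : R := m.+2%:R^-1.

Let del_gt0 m : 0 < del m. Proof. by rewrite invr_gt0. Qed.

Let del_lt1 m : del m < 1. Proof. by rewrite invf_lt1// ltr1n. Qed.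

Let del_small e : 0 < e -> exists M, forall m, (M <= m)%N -> del m < e.
Proof.
move=> e0; exists (Num.trunc e^-1) => m Mm.
rewrite invf_plt ?posrE// (lt_le_trans (truncnS_gt _))// ler_nat.
by rewrite (leq_trans _ (leqnSn _)).
Qed.

Let liminf_quot x : ((phi x * F x - ell x)%:E <=
  limn_einf (fun m => (quot (del m) x - ell x)%:E))%E.
Proof.
apply/lee_subgt0Pr => e e0.
have p0 : 0 < phi x * (`|x| + 1) by rewrite mulr_gt0 ?expR_gt0// ltr_wpDl.
have e'0 : 0 < e / (phi x * (`|x| + 1)) by rewrite divr_gt0.
have [t0 t00 tP] := directional_expansion psi2 x (- x) e'0.
have [M MP] := del_small t00.
apply: (@limn_einf_ge _ _ _ M) => m /MP dm.
rewrite -EFinB lee_fin addrAC lerD2r /quot ler_pdivlMr// shrinkE.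
rewrite (le_trans _ (phi_diff _ _))//.
have := tP _ (del_gt0 m) dm; rewrite ler_norml => /andP[_].
rewrite dotpNr normrN -/T -/(F x) => A.
have B : del m * (F x - e / (phi x * (`|x| + 1)) * `|x|) <= psi x - psi (x + del m *: - x).
  rewrite mulrBr; move: A; rewrite mulrN.
  by move: (del m * F x) (del m * _) (psi x) (psi _) => a b c f; lra.
have := ler_wpM2l (expR_ge0 (- psi x)) B; rewrite -/(phi x); apply: le_trans.
rewrite mulrC mulrCA ler_wpM2l ?(ltW (del_gt0 _))// mulrBr lerD2l lerN2.
have -> : phi x * (e / (phi x * (`|x| + 1)) * `|x|) = e * (`|x| / (`|x| + 1)).
  field; rewrite !gt_eqF ?expR_gt0// ltr_wpDl//.
by rewrite ler_piMr ?(ltW e0)// ler_pdivrMr ?ltr_wpDl// mul1r lerDl.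
Qed.

Let I := fine (\int[leb R n]_x (phi x)%:E)%E.
Let L := fine (\int[leb R n]_x (ell x)%:E)%E.

Let IE : (\int[leb R n]_x (phi x)%:E)%E = I%:E.
Proof. by rewrite fineK// integrable_fin_num. Qed.

Let LE : (\int[leb R n]_x (ell x)%:E)%E = L%:E.
Proof. by rewrite fineK// integrable_fin_num//; exact: ell_integrable. Qed.

Let I0 : 0 <= I. Proof. by rewrite fine_ge0// integral_ge0. Qed.

Let integral_shrink m :
  (\int[leb R n]_x (phi (0 + (1 - del m) *: x))%:E)%E = ((1 - del m) ^- n * I)%:E.
Proof.
have s0 : 0 < 1 - del m by rewrite subr_gt0.
rewrite EFinM -IE (integral_scale 0 s0 (f := fun x => (phi x)%:E))//.
by rewrite muleA -EFinM mulVf ?mul1e// expf_neq0// gt_eqF.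
Qed.

Let shrink_integrable m : (leb R n).-integrable [set: 'rV[R]_n]
  (fun x => (phi (0 + (1 - del m) *: x))%:E).
Proof.
apply/integrableP; split.
  apply/measurable_EFinP; apply: measurableT_comp; first exact: continuous_measurable_rV.
  exact: measurable_rV_scale.
under eq_integral do rewrite gee0_abs ?lee_fin ?expR_ge0//.
by rewrite integral_shrink ltry.
Qed.

Let quot_integrable m : (leb R n).-integrable [set: 'rV[R]_n]
  (fun x => (quot (del m) x)%:E).
Proof.
apply: (@eq_integrable _ _ _ _ _ _ (fun x : 'rV[R]_n => ((del m)^-1)%:E *
   ((phi (0 + (1 - del m) *: x)%R)%:E - (phi x)%:E))%E) => //.
  by move=> x _; rewrite -EFinB -EFinM mulrC.
by apply: integrableZl => //; apply: integrableB.
Qed.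

Let integral_quot m : (\int[leb R n]_x (quot (del m) x - ell x)%:E)%E =
  (((1 - del m) ^- n - 1) / del m * I - L)%:E.
Proof.
have -> : (\int[leb R n]_x (quot (del m) x - ell x)%:E =
    \int[leb R n]_x (quot (del m) x)%:E - \int[leb R n]_x (ell x)%:E)%E.
  by rewrite -integralB//; exact: ell_integrable.
rewrite LE EFinB; congr (_ - _)%E.
have -> : (\int[leb R n]_x (quot (del m) x)%:E = ((del m)^-1)%:E *
   (\int[leb R n]_x ((phi (0 + (1 - del m) *: x)%R)%:E - (phi x)%:E)))%E.
  rewrite -integralZl//; last exact: integrableB.
  by apply: eq_integral => x _; rewrite -EFinB -EFinM mulrC.
rewrite integralB// integral_shrink IE -EFinB -EFinM; congr _%:E.
by ring.
Qed.

(** The limit of (s^-n - 1) / (1 - s) as s tends to 1 is n; Bernoulli's inequality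
    makes the upper bound explicit. *)
Let quot_rate e : 0 < e -> exists M, forall m, (M <= m)%N ->
  ((1 - del m) ^- n - 1) / del m <= n%:R + e.
Proof.
move=> e0; have ne : 0 < n%:R + e by rewrite ltr_wpDl.
have n1 : 0 < n%:R + 1 :> R by rewrite ltr_wpDl.
have [|M MP] := @del_small (e / ((n%:R + 1) * (n%:R + e))).
  by rewrite divr_gt0// mulr_gt0.
exists M => m /MP; have d0 := del_gt0 m; have d1 := del_lt1 m.
rewrite ltr_pdivlMr ?mulr_gt0// => h.
have B : 1 - n%:R * del m <= (1 - del m) ^+ n.
  by apply: bernoulli; rewrite !ltW.
have n0 : 0 <= n%:R :> R by [].
have nd : 0 < 1 - n%:R * del m.
  move: (n%:R) (del m) n0 n1 ne d0 d1 h => N d n0 n1 ne d0 d1 h; nra.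
have P0 : 0 < (1 - del m) ^+ n by rewrite exprn_gt0// subr_gt0.
rewrite ler_pdivrMr//.
rewrite (@le_trans _ _ ((1 - n%:R * del m)^-1 - 1))//.
  by rewrite lerD2r lef_pV2 ?posrE.
rewrite lerBlDr -[leLHS]mul1r ler_pdivrMr//.
move: (n%:R) (del m) n0 n1 ne d0 d1 h nd => N d n0 n1 ne d0 d1 h nd; nra.
Qed.

Let gap_ge0 x : (0 <= (phi x * F x - ell x)%:E)%E.
Proof. by rewrite lee_fin subr_ge0 ell_le. Qed.

Let mell : measurable_fun setT ell.
Proof.
apply: measurable_funM; first exact: continuous_measurable_rV.
by apply: measurable_funB => //; exact: continuous_measurable_rV.
Qed.

Let mgap : measurable_fun setT (fun x => (phi x * F x - ell x)%:E).
Proof. by apply/measurable_EFinP; exact: measurable_funB. Qed.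

(** Fatou's lemma for the nonnegative functions quot - ell. *)
Let gap_le e : 0 < e ->
  (\int[leb R n]_x (phi x * F x - ell x)%:E <= ((n%:R + e) * I - L)%:E)%E.
Proof.
move=> e0; pose h m x := (quot (del m) x - ell x)%:E.
have mh m : measurable_fun setT (h m).
  apply/measurable_EFinP; apply: measurable_funB => //.
  by have /measurable_EFinP := measurable_int _ (quot_integrable m).
have h0 m x : (0 <= h m x)%E.
  by rewrite lee_fin subr_ge0 ell_le_quot// del_gt0 (ltW (del_lt1 m)).
apply: (@le_trans _ _ (\int[leb R n]_x limn_einf (h ^~ x))%E).
  apply: ge0_le_integral => //.
  exact: measurable_limn_einf.
apply: (le_trans (fatou _ measurableT mh (fun m x _ => h0 m x))).
have [M MP] := quot_rate e0.
rewrite limn_einf_lim; apply: lime_le; first exact: is_cvg_einfs.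
apply: nearW => m; apply: (@le_trans _ _ (\int[leb R n]_x h (maxn m M) x)%E).
  by apply: ereal_inf_lbound; exists (maxn m M) => //=; rewrite leq_maxl.
rewrite integral_quot lee_fin lerD2r ler_wpM2r//.
by apply: MP; rewrite leq_maxr.
Qed.

Lemma phi_dot_grad_integrable :
  (leb R n).-integrable [set: 'rV[R]_n] (fun x => (phi x * F x)%:E).
Proof.
have gi : (leb R n).-integrable [set: 'rV[R]_n] (fun x => (phi x * F x - ell x)%:E).
  apply/integrableP; split => //.
  under eq_integral do rewrite gee0_abs//.
  exact: le_lt_trans (gap_le ltr01) (ltry _).
apply: (@eq_integrable _ _ _ _ _ _
  (fun x => (phi x * F x - ell x)%:E + (ell x)%:E)%E) => //.
  by move=> x _; rewrite -EFinD subrK.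
by apply: integrableD => //; exact: ell_integrable.
Qed.

Lemma integral_phi_dot_grad_le :
  (\int[leb R n]_x (phi x * F x)%:E <= (n%:R * I)%:E)%E.
Proof.
apply/lee_addgt0Pr => e e0.
have I1 : 0 < I + 1 by rewrite ltr_wpDl.
have e'0 : 0 < e / (I + 1) by rewrite divr_gt0.
have := gap_le e'0.
have -> : (\int[leb R n]_x (phi x * F x - ell x)%:E =
    \int[leb R n]_x (phi x * F x)%:E - L%:E)%E.
  by rewrite -LE -integralB//; [exact: phi_dot_grad_integrable|exact: ell_integrable].
rewrite leeBlDr// => /le_trans; apply.
rewrite -!EFinD lee_fin subrK mulrDl lerD2l.
by rewrite mulrAC ler_pdivrMr// ler_pM2l// lerDl.
Qed.

End log_concave_integrability.

(** * The inequality *)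

Section inequality.
Context (R : realType) (n : nat) (phi : 'rV[R]_n -> R).
Hypotheses (phi0 : forall x, 0 < phi x) (phi2 : C2 phi).
Let psi x := - ln (phi x).
Hypothesis psi_sc : strictly_convex psi.
Let mu := leb R n.
Hypothesis phi_int : mu.-integrable [set: 'rV[R]_n] (EFin \o phi).
Hypothesis dual_int : mu.-integrable [set: 'rV[R]_n] (EFin \o dual phi).

Let T := grad psi.
Let H := hessian psi.
Let E x := expR (dotp (grad phi x) x / phi x) * phi x ^- 2 * \det (H x).
Hypothesis E_int : mu.-integrable [set: 'rV[R]_n]
  (fun x => (phi x)%:E * lne (E x)%:E)%E.

Let F x := dotp (T x) x.

Let psi2 : C2 psi. Proof. exact: C2_ln. Qed.

Let expNpsi : (fun x => expR (- psi x)) = phi.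
Proof. by apply/funext => x; rewrite opprK lnK ?posrE. Qed.

Lemma radial_logderiv x : dotp (grad phi x) x / phi x = - F x.
Proof.
rewrite /F /dotp -sumrN mulr_suml; apply: eq_bigr => i _.
by rewrite !mxE partial_Nln//; [ring|exact: phi2.1].
Qed.

Let I := fine (\int[mu]_x (phi x)%:E)%E.
Let G := fine (\int[mu]_x (dual phi x)%:E)%E.
Let P := fine (\int[mu]_x (phi x * psi x)%:E)%E.
Let Q := fine (\int[mu]_x (phi x * F x)%:E)%E.

Lemma phi_psi_int : mu.-integrable [set: 'rV[R]_n] (fun x => (phi x * psi x)%:E).
Proof.
have := @phi_psi_integrable _ _ psi psi2 psi_sc; rewrite expNpsi => /(_ phi_int).
by under eq_fun do rewrite -/(psi _) opprK lnK ?posrE//.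
Qed.

Let psi_int := phi_psi_int.

Lemma radial_int : mu.-integrable [set: 'rV[R]_n] (fun x => (phi x * F x)%:E).
Proof.
have := @phi_dot_grad_integrable _ _ psi psi2 psi_sc; rewrite expNpsi => /(_ phi_int).
by under eq_fun do rewrite opprK lnK ?posrE//.
Qed.

Let F_int := radial_int.

Lemma radial_integral_le : Q <= n%:R * I.
Proof.
have := @integral_phi_dot_grad_le _ _ psi psi2 psi_sc; rewrite expNpsi => /(_ phi_int).
under eq_integral do rewrite opprK lnK ?posrE//.
move=> h; rewrite -lee_fin /Q fineK//; last exact: integrable_fin_num.
rewrite /I; have <- // : (\int[mu]_x (expR (- psi x))%:E = \int[mu]_x (phi x)%:E)%E.
by apply: eq_integral => x _; rewrite opprK lnK ?posrE.
Qed.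

Let N : set 'rV[R]_n := [set x | \det (H x) != 0].

Let mN : measurable N.
Proof.
rewrite -[X in measurable X]setTI (_ : N = (fun x => \det (H x)) @^-1` (~` [set 0])).
  by apply: (measurable_det_hessian psi2) => //; exact: measurableC.
by apply/seteqP; split => x /= /eqP.
Qed.

Let det_gt0 x : N x -> 0 < \det (H x).
Proof. by move=> Nx; have [] := integral_linear (hessian_posdef psi2 psi_sc Nx). Qed.

(** The product of phi x with lne (E x) is finite almost everywhere, and lne is
    -oo at 0. *)
Let N_null : mu (~` N) = 0%E.
Proof.
have /negligibleP : mu.-negligible (~` N).
  apply: negligibleS (integrable_ae measurableT E_int) => x /=.
  rewrite /N /= => /negP; rewrite negbK => /eqP D0; apply/not_implyP; split => //.
  rewrite /E D0 mulr0 /= lexx.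
  by rewrite gt0_muleNy// lte_fin.
by apply; exact: measurableC.
Qed.

Let integralN (f : 'rV[R]_n -> \bar R) : mu.-integrable setT f ->
  (\int[mu]_x f x = \int[mu]_(x in N) f x)%E.
Proof.
move=> fi; rewrite (negligible_integral (measurableC mN) measurableT fi N_null).
by rewrite setTD setCK.
Qed.

Let integrable_ofN (f : 'rV[R]_n -> \bar R) : measurable_fun setT f ->
  mu.-integrable N f -> mu.-integrable setT f.
Proof.
move=> mf fi; apply/(negligible_integrable (measurableC mN) measurableT mf N_null).
by rewrite setTD setCK.
Qed.

Let integrable_toN (f : 'rV[R]_n -> \bar R) : mu.-integrable setT f -> mu.-integrable N f.
Proof. by move=> fi; apply: (integrableS measurableT). Qed.

Let E_gt0 x : N x -> 0 < E x.
Proof.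
move=> /det_gt0 D0; rewrite mulr_gt0// mulr_gt0 ?expR_gt0//.
by rewrite invr_gt0 exprn_gt0.
Qed.

Let Sg := fine (\int[mu]_x ((phi x)%:E * lne (E x)%:E))%E.

Let SE x : N x -> ((phi x)%:E * lne (E x)%:E = (phi x * ln (E x))%:E)%E.
Proof. by move=> /E_gt0 E0; rewrite lne_EFin. Qed.

Let lnE x : N x -> ln (E x) = ln (\det (H x)) + 2 * psi x - F x.
Proof.
move=> Nx; have D0 := det_gt0 Nx.
rewrite /E radial_logderiv lnM ?posrE// ?mulr_gt0 ?expR_gt0 ?invr_gt0 ?exprn_gt0//.
rewrite lnM ?posrE ?expR_gt0 ?invr_gt0 ?exprn_gt0// expRK lnV ?posrE ?exprn_gt0//.
rewrite lnXn// /psi mulr2n; ring.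
Qed.

Let logdet x := ((phi x)%:E * lne (\det (H x))%:E)%E.

Let logdetE x : N x -> logdet x = ((phi x)%:E * lne (E x)%:E - 2%:E * (phi x * psi x)%:E +
  (phi x * F x)%:E)%E.
Proof.
move=> Nx; rewrite SE// /logdet lne_EFin ?det_gt0// lnE//.
by rewrite -!EFinM -EFinB -EFinD; congr _%:E; ring.
Qed.

Let mlogdet : measurable_fun setT logdet.
Proof.
have mD := measurable_det_hessian psi2.
apply: emeasurable_funM; first exact: (measurable_int mu phi_int).
apply: measurable_fun_ifT.
- exact: measurable_fun_ler.
- exact: measurable_cst.
- by apply/measurable_EFinP; exact: (measurableT_comp (@measurable_ln R) mD).
Qed.

Let decomposition_integrable : mu.-integrable [set: 'rV[R]_n]
  (fun x => (phi x)%:E * lne (E x)%:E - 2%:E * (phi x * psi x)%:E + (phi x * F x)%:E)%E.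
Proof.
apply: integrableD => //; apply: integrableB => //.
exact: integrableZl.
Qed.

Lemma integral_log_det_eq : (\int[mu]_x logdet x = (Sg - 2 * P + Q)%:E)%E.
Proof.
have logdetN : {in N, (fun x => (phi x)%:E * lne (E x)%:E - 2%:E * (phi x * psi x)%:E +
    (phi x * F x)%:E)%E =1 logdet} by move=> x /[!inE] Nx; rewrite logdetE.
have logdet_int : mu.-integrable setT logdet.
  apply: integrable_ofN => //.
  by apply: eq_integrable logdetN _ => //; exact: integrable_toN.
rewrite integralN// -(eq_integral _ _ logdetN) -integralN//.
rewrite integralD//; last first.
  by apply: integrableB => //; exact: integrableZl.
rewrite integralB//; last exact: integrableZl.
rewrite integralZl//; transitivity (Sg%:E - 2%:E * P%:E + Q%:E)%E => //.
congr (_ - _ * _ + _)%E.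
- by rewrite /Sg fineK//; exact: integrable_fin_num.
- by rewrite /P fineK//; exact: integrable_fin_num.
- by rewrite /Q fineK//; exact: integrable_fin_num.
Qed.

Let dualT x := dual phi (T x) * \det (H x).

Let phiE x : N x -> phi x * E x = dualT x.
Proof.
move=> Nx; rewrite /dualT dual_grad// /E radial_logderiv -/psi -/T -/(F x).
rewrite expRD (_ : expR (psi x) = (phi x)^-1); last by rewrite /psi expRN lnK ?posrE.
by rewrite -exprVn expr2; field; rewrite gt_eqF.
Qed.

Let mdual : measurable_fun setT (dual phi).
Proof. by have /measurable_EFinP := measurable_int mu dual_int. Qed.

Let mdualT : measurable_fun setT (fun x => (dualT x)%:E).
Proof.
apply/measurable_EFinP; apply: measurable_funM; last exact: (measurable_det_hessian psi2).
exact: (measurableT_comp mdual (measurable_grad psi2)).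
Qed.

Let dualT_ge0 x : N x -> (0 <= (dualT x)%:E)%E.
Proof. by move=> /det_gt0 D0; rewrite lee_fin mulr_ge0 ?dual_ge0// ltW. Qed.

Let integral_dualT_le : (\int[mu]_(x in N) (dualT x)%:E <= G%:E)%E.
Proof.
have := integral_dual_grad_le phi0 psi2 psi_sc mdual; move=> /le_trans; apply.
by rewrite /G fineK//; exact: integrable_fin_num.
Qed.

Let dualT_int : mu.-integrable N (fun x => (dualT x)%:E).
Proof.
apply/integrableP; split; first exact: measurable_funTS.
rewrite (eq_integral (fun x => (dualT x)%:E)) => [|x /[!inE] Nx].
  exact: le_lt_trans integral_dualT_le (ltry _).
by rewrite gee0_abs// dualT_ge0.
Qed.

(** Jensen's inequality before optimisation: ln t <= t / a + ln a - 1, with t = E x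
    and phi E = dual phi (T x) * det (H x). The optimal a is G / I. *)
Lemma tangent_bound a : 0 < a -> Sg <= G / a + I * (ln a - 1).
Proof.
move=> a0; rewrite -lee_fin /Sg fineK; last exact: integrable_fin_num.
rewrite integralN//.
apply: (@le_trans _ _ (\int[mu]_(x in N)
    ((a^-1)%:E * (dualT x)%:E + (ln a - 1)%:E * (phi x)%:E))%E).
  apply: le_integral; [exact: mN|exact: integrable_toN|..].
    by apply: integrableD => //; apply: integrableZl => //; exact: integrable_toN.
  move=> x /[!inE] Nx; rewrite SE// -!EFinM -EFinD lee_fin -phiE//.
  have E0 := E_gt0 Nx.
  have := @ln_le_subr1 _ (E x / a); rewrite divr_gt0// => /(_ isT).
  rewrite ln_div ?posrE// => h.
  have := ler_wpM2l (ltW (phi0 x)) h; rewrite mulrBr.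
  rewrite (_ : _ * (E x / a - 1) = a^-1 * (phi x * E x) - phi x); last by ring.
  move: (phi x * ln (E x)) => b; move: (a^-1 * (phi x * E x)) => c.
  by move: (phi x) (ln a) => f l; lra.
rewrite integralD//; last 2 first.
- by apply: integrableZl.
- by apply: integrableZl => //; exact: integrable_toN.
rewrite !integralZl//; last exact: integrable_toN.
rewrite -(integralN phi_int).
apply: (@le_trans _ _ ((a^-1)%:E * G%:E + (ln a - 1)%:E * I%:E)%E); last first.
  by rewrite -!EFinM -EFinD lee_fin le_eqVlt; apply/orP; left; apply/eqP; ring.
apply: leeD; first by apply: lee_wpmul2l => //; rewrite lee_fin invr_ge0 ltW.
by rewrite /I fineK//; exact: integrable_fin_num.
Qed.

Lemma integral_phi_gt0 : 0 < I.
Proof.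
rewrite fine_gt0//; apply/andP; split; last exact: integrable_lty phi_int.
by apply: integral_continuous_gt0 => //; apply: C1_continuous; exact: phi2.1.
Qed.

(** If G were 0, [tangent_bound] with ln a = Sg / I would give Sg <= Sg - I. *)
Lemma integral_dual_gt0 : 0 < G.
Proof.
rewrite lt_neqAle; apply/andP; split; last first.
  by rewrite fine_ge0// integral_ge0// => x _; rewrite lee_fin dual_ge0.
apply/eqP => G0; have I0 := integral_phi_gt0.
have := tangent_bound (expR_gt0 (Sg / I)); rewrite -G0 mul0r add0r expRK.
by rewrite mulrBr mulrCA mulfV ?gt_eqF// !mulr1 leNgt gtrBl I0.
Qed.

Lemma integral_log_det_le : (\int[mu]_x logdet x <=
  (- 2 * P - 2 * (I * ln I) + I * (n%:R + ln I + ln G))%:E)%E.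
Proof.
have I0 := integral_phi_gt0; have G0 := integral_dual_gt0.
rewrite integral_log_det_eq lee_fin.
have := @tangent_bound (G / I); rewrite divr_gt0// => /(_ isT).
rewrite invf_div mulrCA mulfV ?gt_eqF// mulr1 ln_div ?posrE//.
move: radial_integral_le; move: (Sg) (Q) (P) (I) (ln I) (ln G) (n%:R) => s q p i li lg N' h1 h2.
by nra.
Qed.

End inequality.

(** * The Gaussian case *)

Section gaussian.
Context (R : realType) (n : nat) (phi : 'rV[R]_n -> R) (C : R) (A : 'M[R]_n).
Hypotheses (C0 : 0 < C) (A0 : posdefmx A).
Hypothesis phiE : forall x, phi x = C * expR (- dotp (x *m A^T) x).
Let psi x := - ln (phi x).
Let mu := leb R n.
Hypothesis phi2 : C2 phi.
Hypothesis psi_sc : strictly_convex psi.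
Hypothesis phi_int : mu.-integrable [set: 'rV[R]_n] (EFin \o phi).
Hypothesis dual_int : mu.-integrable [set: 'rV[R]_n] (EFin \o dual phi).

Let q x := dotp (x *m A) x.

Let AT : A^T = A. Proof. by case: A0. Qed.

Let phi0 x : 0 < phi x.
Proof. by rewrite phiE mulr_gt0 ?expR_gt0. Qed.

Let psi2 : C2 psi. Proof. exact: C2_ln. Qed.

Let psiE x : psi x = q x - ln C.
Proof.
rewrite /psi phiE lnM ?posrE ?expR_gt0// expRK opprD opprK addrC.
by rewrite AT.
Qed.

Let is_derive_quadratic (a b c : R) :
  is_derive (0 : R) 1 (fun t : R => a + t * b + t * t * c) b.
Proof.
have hid := @is_derive_id R R 0 1.
have hb := is_deriveM hid (is_derive_cst b (0 : R) (1 : R)).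
have hc := is_deriveM (is_deriveM hid hid) (is_derive_cst c (0 : R) (1 : R)).
have H := is_deriveD (is_deriveD (is_derive_cst a (0 : R) (1 : R)) hb) hc.
apply: (is_derive_eq H).
by rewrite /GRing.scale/= !(mulr0, mul0r, addr0, add0r) mulr1.
Qed.

Let dotpA u v : dotp (u *m A) v = dotp (v *m A) u.
Proof. by rewrite dotp_mulmx_tr AT dotpC. Qed.

Let partial_psi i x : partial i psi x = 2 * (x *m A) ord0 i.
Proof.
suff [_ E] : is_derive x (delta_mx ord0 i) psi (2 * (x *m A) ord0 i) by exact: E.
apply: line_is_derive.
rewrite (_ : (fun s : R => _) = (fun t : R => psi x + t * (2 * (x *m A) ord0 i) +
    t * t * q (delta_mx ord0 i))); first exact: is_derive_quadratic.
apply/funext => t; rewrite !psiE /q mulmxDl -scalemxAl.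
rewrite !(dotpDl, dotpDr, dotpZl, dotpZr) (dotpA (delta_mx _ _)) !dotp_delta.
by ring.
Qed.

Let hessian_psi x : hessian psi x = 2 *: A.
Proof.
apply/matrixP => i j; rewrite mxE [RHS]mxE.
have -> : partial j psi = (fun x => 2 * (x *m A) ord0 j).
  by apply/funext => y; exact: partial_psi.
suff [_ E] : is_derive x (delta_mx ord0 i) (fun x => 2 * (x *m A) ord0 j) (2 * A i j).
  exact: E.
apply: line_is_derive.
rewrite (_ : (fun s : R => _) = (fun t : R => 2 * (x *m A) ord0 j + t * (2 * A i j) +
    t * t * 0)); first exact: is_derive_quadratic.
apply/funext => t; rewrite mulmxDl -scalemxAl -rowE !mxE.
by ring.
Qed.

Let grad_psi x : grad psi x = 2 *: (x *m A).
Proof. by apply/rowP => i; rewrite [LHS]mxE partial_psi [RHS]mxE. Qed.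

Let F x := dotp (grad psi x) x.

Let FE x : F x = 2 * q x.
Proof. by rewrite /F grad_psi dotpZl. Qed.

Let D := \det (2 *: A).

Let I := fine (\int[mu]_x (phi x)%:E)%E.
Let G := fine (\int[mu]_x (dual phi x)%:E)%E.
Let P := fine (\int[mu]_x (phi x * psi x)%:E)%E.
Let Q := fine (\int[mu]_x (phi x * F x)%:E)%E.

Let A2 (v : 'rV[R]_n) : v != 0 -> 0 < dotp (v *m (2 *: A)) v.
Proof.
by move=> v0; rewrite -scalemxAr dotpZl mulr_gt0// -{1}AT; exact: A0.2.
Qed.

Let D0 : 0 < D. Proof. by have [] := integral_linear A2. Qed.

Let IE : (\int[mu]_x (phi x)%:E)%E = I%:E.
Proof. by rewrite fineK//; exact: integrable_fin_num. Qed.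

Let mdual : measurable_fun setT (dual phi).
Proof. by have /measurable_EFinP := measurable_int mu dual_int. Qed.

Let phi_ge0 x : (0 <= (phi x)%:E)%E.
Proof. by rewrite lee_fin ltW. Qed.

(** The substitution y = T x = x (2 A) is linear, so it gives the integral of the
    dual function exactly. *)
Lemma gaussian_dual_integral : G = D * I / C ^+ 2.
Proof.
have [_ L] := integral_linear A2.
rewrite /G (L 0 (fun y => (dual phi y)%:E)) => [||x]; last 2 first.
- exact/measurable_EFinP.
- by rewrite lee_fin dual_ge0.
rewrite (eq_integral (fun x => (C ^- 2)%:E * (phi x)%:E)%E) => [|x _].
  rewrite integralZl// IE -!EFinM /= -/D; ring.
rewrite add0r -scalemxAr -grad_psi dual_grad// -/(psi x) -/(F x) FE psiE phiE AT -/(q x).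
rewrite -EFinM; congr _%:E.
have -> : q x - ln C - 2 * q x = - q x - ln C by ring.
rewrite expRD [expR (- ln C)]expRN lnK ?posrE// expr2.
by field; rewrite gt_eqF.
Qed.

Let F_int : mu.-integrable [set: 'rV[R]_n] (fun x => (phi x * F x)%:E).
Proof. exact: (radial_int phi0 phi2 psi_sc phi_int). Qed.

Let q_ge0 x : 0 <= q x.
Proof.
have [->|x0] := eqVneq x 0; last by rewrite ltW// /q -{1}AT; exact: A0.2.
by rewrite /q mul0mx; apply: sumr_ge0 => i _; rewrite mxE mul0r.
Qed.

Let mphi : measurable_fun setT (fun x => (phi x)%:E).
Proof. exact: measurable_int phi_int. Qed.

(** phi x - phi (x / u) <= (u^-2 - 1) q x phi x, integrated. Letting u tend to 1
    gives the inequality converse to [radial_integral_le]. *)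
Let contraction_bound u : 0 < u < 1 -> 2 * u ^+ 2 * (1 - u ^+ n) * I <= (1 - u ^+ 2) * Q.
Proof.
move=> /andP[u0 u1]; have us0 : 0 < u^-1 by rewrite invr_gt0.
pose c := (u ^- 2 - 1) / 2.
have c0 : 0 <= c.
  by rewrite divr_ge0// subr_ge0 invf_ge1 ?exprn_gt0// expr_le1// ltW.
have ms : measurable_fun setT (fun x : 'rV[R]_n => (phi (0 + u^-1 *: x))%:E).
  exact: (measurableT_comp mphi (measurable_rV_scale u^-1 (0 : 'rV[R]_n))).
have Is : (\int[mu]_x (phi (0 + u^-1 *: x))%:E)%E = (u ^+ n * I)%:E.
  rewrite EFinM -IE (integral_scale 0 us0 (f := fun x => (phi x)%:E))//.
  by rewrite muleA -EFinM -exprMn mulfV ?expr1n ?mul1e// gt_eqF.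
have h : (I%:E <= (u ^+ n * I)%:E + c%:E * Q%:E)%E.
  have QE : (\int[mu]_x (phi x * F x)%:E)%E = Q%:E.
    by rewrite fineK//; exact: integrable_fin_num.
  have si : mu.-integrable [set: 'rV[R]_n] (fun x : 'rV[R]_n => (phi (0 + u^-1 *: x))%:E).
    apply/integrableP; split => //.
    under eq_integral do rewrite gee0_abs//.
    by rewrite Is ltry.
  rewrite -Is -QE -integralZl// -integralD//; last exact: integrableZl.
  rewrite -IE; apply: le_integral => //.
    by apply: integrableD => //; exact: integrableZl.
  move=> x _; rewrite -EFinM -EFinD lee_fin FE add0r.
  have -> : phi (u^-1 *: x) = phi x * expR (- (u ^- 2 - 1) * q x).
    rewrite !phiE -mulrA -expRD AT; congr (_ * expR _).
    by rewrite -scalemxAl dotpZl dotpZr -/(q x) -exprVn; ring.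
  have := expR_ge1Dx (- (u ^- 2 - 1) * q x) => /(ler_wpM2l (ltW (phi0 x))) k.
  rewrite -lerBlDr (le_trans _ k)// /c.
  by rewrite le_eqVlt; apply/orP; left; apply/eqP; field; rewrite gt_eqF.
move: h; rewrite -EFinM -EFinD lee_fin => h.
have u20 : 0 < 2 * u ^+ 2 by rewrite mulr_gt0// exprn_gt0.
have := ler_wpM2l (ltW u20) h; rewrite mulrDr.
have -> : 2 * u ^+ 2 * (c * Q) = (1 - u ^+ 2) * Q.
  by rewrite /c; field; rewrite gt_eqF.
rewrite -lerBlDl => k; apply: le_trans k.
by rewrite le_eqVlt; apply/orP; left; apply/eqP; ring.
Qed.

Let power_bound (d : R) m : 0 <= d <= 1 -> (1 - d) ^+ m * (1 + m%:R * d) <= 1.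
Proof.
move=> /andP[d0 d1]; elim: m => [|m IH]; first by rewrite mul0r addr0 mulr1.
apply: le_trans IH; rewrite exprSr -mulrA ler_wpM2l ?exprn_ge0 ?subr_ge0//.
rewrite -natr1 -subr_ge0.
have -> : 1 + m%:R * d - (1 - d) * (1 + (m%:R + 1) * d) = (m%:R + 1) * d ^+ 2 by ring.
by rewrite mulr_ge0 ?sqr_ge0// addr_ge0.
Qed.

Lemma gaussian_radial_integral : Q = n%:R * I.
Proof.
apply/eqP; rewrite eq_le (radial_integral_le phi0 phi2 psi_sc phi_int)/=.
have I0 : 0 <= I by rewrite fine_ge0// integral_ge0.
have Q0 : 0 <= Q.
  by rewrite fine_ge0// integral_ge0// => x _; rewrite lee_fin FE !mulr_ge0// ltW.
apply/ler_addgt0Pr => e e0.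
pose K : R := n%:R * I * (n.+2)%:R + 1.
have K0 : 0 < K by rewrite ltr_wpDl// !mulr_ge0.
pose d := Num.min (2^-1) (e / K).
have d0 : 0 < d by rewrite lt_min invr_gt0 divr_gt0// ltr0n.
have d1 : d < 1 by rewrite gt_min invf_lt1// ltr1n.
have u01 : 0 < 1 - d < 1 by rewrite subr_gt0 d1 gtrBl d0.
have := contraction_bound u01.
have dd : 0 <= d <= 1 by rewrite !ltW.
have B := power_bound n dd.
have B2 := bernoulli n.+2 dd.
have Kd : K * d <= e by rewrite mulrC -ler_pdivlMr// ge_min lexx orbT.
have u20 : 0 <= 2 * (1 - d) ^+ 2 by rewrite mulr_ge0// sqr_ge0.
have S1 : (1 - d) ^+ n * (n%:R * d) <= 1 - (1 - d) ^+ n.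
  by rewrite lerBrDl; move: B; rewrite mulrDr mulr1.
have := ler_wpM2r I0 (ler_wpM2l u20 S1) => S2 /(le_trans S2) S3.
have S4 : (1 - (1 - d) ^+ 2) * Q <= 2 * d * Q.
  rewrite ler_wpM2r// -subr_ge0.
  by rewrite (_ : _ - _ = d ^+ 2) ?sqr_ge0//; ring.
have {S2 S3 S4} : 2 * d * ((1 - d) ^+ n.+2 * (n%:R * I)) <= 2 * d * Q.
  apply: le_trans S4; apply: le_trans S3.
  by rewrite le_eqVlt; apply/orP; left; apply/eqP; rewrite 2!exprS expr2; ring.
rewrite ler_pM2l ?mulr_gt0// => S5.
have nI0 : 0 <= n%:R * I by rewrite mulr_ge0.
have := ler_wpM2r nI0 B2 => S6.
have {}S6 := le_trans S6 S5.
have {}S6 : n%:R * I <= Q + n%:R * I * n.+2%:R * d.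
  move: S6; rewrite mulrBl mul1r lerBlDr => /le_trans; apply; rewrite lerD2l.
  by rewrite le_eqVlt; apply/orP; left; apply/eqP; ring.
apply: (le_trans S6); rewrite lerD2l (le_trans _ Kd)// /K mulrDl mul1r lerDl.
exact: ltW.
Qed.

Lemma gaussian_psi_integral : P = Q / 2 - ln C * I.
Proof.
rewrite /P (_ : (\int[mu]_x (phi x * psi x)%:E)%E = (Q / 2 - ln C * I)%:E)//.
transitivity ((2^-1)%:E * Q%:E - (ln C)%:E * I%:E)%E; last by rewrite -!EFinM -EFinB mulrC.
have -> : Q%:E = (\int[mu]_x (phi x * F x)%:E)%E.
  by rewrite fineK//; exact: integrable_fin_num.
rewrite -IE -!integralZl// -integralB//; last 2 first.
- exact: integrableZl.
- exact: integrableZl.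
apply: eq_integral => x _; rewrite -!EFinM -EFinB psiE FE; congr _%:E.
by field.
Qed.

Lemma gaussian_equality :
  (\int[mu]_x ((phi x)%:E * lne (\det (hessian psi x))%:E) =
  (- 2 * P - 2 * (I * ln I) + I * (n%:R + ln I + ln G))%:E)%E.
Proof.
have I0 : 0 < I := integral_phi_gt0 phi0 phi2 phi_int.
transitivity (ln D * I)%:E.
  rewrite EFinM -IE -integralZl//; apply: eq_integral => x _.
  by rewrite hessian_psi -/D lne_EFin// muleC.
congr _%:E; rewrite gaussian_psi_integral gaussian_radial_integral gaussian_dual_integral.
rewrite ln_div ?posrE ?mulr_gt0 ?exprn_gt0// lnM ?posrE// lnXn// mulr2n.
by field.
Qed.

End gaussian.

(** * Conclusion *)

Lemma C2_of_C2_on (R : realType) n (f : 'rV[R]_n -> R) : C2_on setT f -> C2 f.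
Proof.
move=> fC; split=> [x i|i x j]; first by have [_ /(_ i)[]] := fC x I.
by have [_ /(_ i)[_ _ /(_ j)]] := fC x I.
Qed.

Theorem corollary2 (R : realType) (n : nat) (phi : 'rV[R]_n -> R) :
  log_concave phi ->
  standing_assumptions phi ->
  let mu := lebesgue_rV R n in
  let lhs : \bar R := (\int[mu]_(x in supp phi)
    ((phi x)%:E * lne (\det (hessian (fun y => - ln (phi y)) x))%:E))%E in
  let rhs : R := 2 * Ent phi +
    normL1 phi * ln (expR n%:R * (\int[mu]_x phi x) * (\int[mu]_x dual phi x)) in
  (lhs <= rhs%:E)%E /\
  ((exists (C : R) (A : 'M[R]_n), [/\ 0 < C, posdefmx A &
      forall x, phi x = C * expR (- dotp (x *m A^T) x)]) ->
   lhs = rhs%:E).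
Proof.
move=> [psi [_ phiE]] [psi_sc phiC phi_int dual_int E_int] mu lhs rhs.
have phi0 x : 0 < phi x by rewrite phiE expR_gt0.
have suppT : supp phi = setT by apply/seteqP; split => // x _; exact: phi0.
rewrite {}/lhs; rewrite suppT in phiC dual_int E_int *.
have phi2 := C2_of_C2_on phiC.
pose I := fine (\int[leb R n]_x (phi x)%:E)%E.
pose G := fine (\int[leb R n]_x (dual phi x)%:E)%E.
pose P := fine (\int[leb R n]_x (phi x * - ln (phi x))%:E)%E.
have I0 : 0 < I := integral_phi_gt0 phi0 phi2 phi_int.
have G0 : 0 < G := integral_dual_gt0 phi0 phi2 psi_sc phi_int dual_int E_int.
have entE : \int[mu]_(x in supp phi) (phi x * ln (phi x)) = - P.
  have pint := phi_psi_int phi0 phi2 psi_sc phi_int.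
  rewrite suppT /P -fineN -integralN; last exact: integrable_add_def.
  by congr fine; apply: eq_integral => x _; rewrite -EFinN -mulrN opprK.
have rhsE : rhs = - 2 * P - 2 * (I * ln I) + I * (n%:R + ln I + ln G).
  rewrite /rhs /Ent entE.
  have -> : normL1 phi = I by [].
  have -> : \int[mu]_x phi x = I by [].
  have -> : \int[mu]_x dual phi x = G by [].
  rewrite !lnM ?posrE ?mulr_gt0 ?expR_gt0// expRK; ring.
rewrite rhsE; split.
  exact: (integral_log_det_le phi0 phi2 psi_sc phi_int dual_int E_int).
move=> [C [A [C0 A0 phiG]]].
exact: (gaussian_equality C0 A0 phiG phi2 psi_sc phi_int dual_int).
Qed.
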